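(* Let $\mathcal{K}$ be Zilber's pseudoexponential field and let $p(x_1,\dots,x_n)\in \mathcal{K}[x_1,\dots,x_n]^E$ be an exponential polynomial with coefficients in $\mathcal{K}$. If there is no exponential polynomial $g(x_1,\dots,x_n)\in\mathcal{K}[x_1,\dots,x_n]^E$ with $p=\exp(g)$, then there is $\bar a\in\mathcal{K}^n$ with $p(\bar a)=0$.
   Context: An E-field is a field $K$ of characteristic $0$ together with a group homomorphism $\exp:(K,+)\to(K^*,\cdot)$. For an E-field $K$, the exponential polynomial ring $K[x_1,\dots,x_n]^E$ is the free E-ring extension of $K$ generated by $x_1,\dots,x_n$; concretely: a partial E-ring is a $\mathbb{Q}$-algebra $R$ without zero divisors with a $\mathbb{Q}$-subspace $A(R)$ and a homomorphism $\exp:(A(R),+)\to(R^*,\cdot)$. For a partial E-ring $R$ let $R'$ be the partial E-ring extension of $R$ such that the domain of $\exp$ in $R'$ is exactly $R$, $R'$ is generated as a ring by $R\cup\exp(R)$, and for $y_1,\dots,y_k\in R$ the transcendence degree of $\exp(y_1),\dots,\exp(y_k)$ over $R$ equals the $\mathbb{Q}$-linear dimension of $y_1,\dots,y_k$ modulo $A(R)$. Then $K[\bar x]^E=\bigcup_m R_m$ where $R_0=K[\bar x]$ (polynomial ring, with $\exp$ defined on $K$) and $R_{m+1}=R_m'$. Elements are called exponential polynomials and can be evaluated at points of $K^n$. For an algebraically closed field $K$ let $G_\alpha(K)=K^\alpha\times(K^* )^\alpha$. For an integer $r\times\alpha$ matrix $C=(c_{i,j})$ let $[C]:G_\alpha(K)\to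 G_r(K)$ map $(\bar z,\bar y)$ to $(u_1,\dots,u_r,v_1,\dots,v_r)$ with $u_i=\sum_j c_{i,j}z_j$, $v_i=\prod_j y_j^{c_{i,j}}$. An irreducible variety $V\subseteq G_\alpha(K)$ is rotund if $\dim([C](V))\ge r$ for every integer $r\times\alpha$ matrix $C$ of rank $r$, $1\le r\le\alpha$. A variety $V\subseteq G_\alpha(K)$ is free if there are no $m_1,\dots,m_\alpha\in\mathbb{Z}$ (not all zero) and $b\in K$ with $V\subseteq\{(\bar u,\bar v):\prod v_i^{m_i}=b\}$ or $V\subseteq\{(\bar u,\bar v):\sum m_iu_i=b\}$. Zilber's pseudoexponential field $\mathcal{K}$ is the (unique up to isomorphism) E-field of cardinality $2^{\aleph_0}$ satisfying Zilber's axioms: $\mathcal{K}$ is an algebraically closed field of characteristic $0$; $\exp$ is surjective onto $\mathcal{K}^*$ with infinite cyclic kernel; the Schanuel property holds; the countable closure property holds; and strong exponential-algebraic closedness holds, which in particular gives: for every irreducible, rotund and free variety $V\subseteq G_\alpha(\mathcal{K})$ there are infinitely many $\bar x\in\mathcal{K}^\alpha$ with $(\bar x,\exp(\bar x))\in V$. *)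

(* Defs.v *)
From HB Require Import structures.
From mathcomp Require Import all_boot all_order all_algebra.
From mathcomp Require Import boolp.
From mathcomp Require Import mpoly.

Set Implicit Arguments.
Unset Strict Implicit.
Unset Printing Implicit Defensive.

Import GRing.Theory.
Local Open Scope ring_scope.
Local Open Scope quotient_scope.

(* [eexp_morph] and [eexp0] make [eexp] a homomorphism from (R, +) into the   *)
(* group of units of R, with inverse [eexp (- x)].                            *)
HB.mixin Record hasExp R & GRing.ComNzRing R := {
  eexp : R -> R;
  eexp0 : eexp 0 = 1;
  eexp_morph : forall x y, eexp (x + y) = eexp x * eexp y
}.

#[short(type="eRingType")]
HB.structure Definition ERing := {R of GRing.ComNzRing R & hasExp R}.

HB.mixin Record hasPchar0 R & GRing.NzSemiRing R := {
  pchar0 : [pchar R] =i pred0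
}.

#[short(type="eFieldType")]
HB.structure Definition EField :=
  {K of GRing.Field K & hasExp K & hasPchar0 K}.

(* The free E-ring extension of K on n generators: terms over K and           *)
(* X_0, ..., X_(n-1), modulo the least E-ring congruence that respects the    *)
(* operations of K.                                                           *)
Inductive eterm (K : Type) (n : nat) :=
| ETConst of K
| ETVar of 'I_n
| ETAdd of eterm K n & eterm K n
| ETOpp of eterm K n
| ETMul of eterm K n & eterm K n
| ETExp of eterm K n.

Arguments ETConst {K n}.
Arguments ETVar {K n}.

Inductive eterm_eq (K : eRingType) (n : nat) : eterm K n -> eterm K n -> Prop :=
| ete_refl t : eterm_eq t t
| ete_sym t u : eterm_eq t u -> eterm_eq u t
| ete_trans t u v : eterm_eq t u -> eterm_eq u v -> eterm_eq t v
| ete_add t t' u u' :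
    eterm_eq t t' -> eterm_eq u u' -> eterm_eq (ETAdd t u) (ETAdd t' u')
| ete_opp t t' : eterm_eq t t' -> eterm_eq (ETOpp t) (ETOpp t')
| ete_mul t t' u u' :
    eterm_eq t t' -> eterm_eq u u' -> eterm_eq (ETMul t u) (ETMul t' u')
| ete_exp t t' : eterm_eq t t' -> eterm_eq (ETExp t) (ETExp t')
| ete_addA t u v : eterm_eq (ETAdd t (ETAdd u v)) (ETAdd (ETAdd t u) v)
| ete_addC t u : eterm_eq (ETAdd t u) (ETAdd u t)
| ete_add0 t : eterm_eq (ETAdd (ETConst 0) t) t
| ete_addN t : eterm_eq (ETAdd (ETOpp t) t) (ETConst 0)
| ete_mulA t u v : eterm_eq (ETMul t (ETMul u v)) (ETMul (ETMul t u) v)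
| ete_mulC t u : eterm_eq (ETMul t u) (ETMul u t)
| ete_mul1 t : eterm_eq (ETMul (ETConst 1) t) t
| ete_mulDl t u v :
    eterm_eq (ETMul (ETAdd t u) v) (ETAdd (ETMul t v) (ETMul u v))
| ete_expD t u : eterm_eq (ETExp (ETAdd t u)) (ETMul (ETExp t) (ETExp u))
| ete_constD c d : eterm_eq (ETConst (c + d)) (ETAdd (ETConst c) (ETConst d))
| ete_constM c d : eterm_eq (ETConst (c * d)) (ETMul (ETConst c) (ETConst d))
| ete_constE c : eterm_eq (ETConst (eexp c)) (ETExp (ETConst c)).

HB.instance Definition _ (K : Type) (n : nat) := gen_eqMixin (eterm K n).
HB.instance Definition _ (K : Type) (n : nat) := gen_choiceMixin (eterm K n).

Fixpoint etval (K S : eRingType) (n : nat) (phi : K -> S) (s : 'I_n -> S)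
    (t : eterm K n) : S :=
  match t with
  | ETConst c => phi c
  | ETVar i => s i
  | ETAdd t u => etval phi s t + etval phi s u
  | ETOpp t => - etval phi s t
  | ETMul t u => etval phi s t * etval phi s u
  | ETExp t => eexp (etval phi s t)
  end.

Lemma etval_eq (K S : eRingType) (n : nat) (phi : {rmorphism K -> S})
    (phiE : forall c, phi (eexp c) = eexp (phi c)) (s : 'I_n -> S) t u :
  eterm_eq t u -> etval phi s t = etval phi s u.
Proof.
elim=> //=.
- by move=> ? ? ? _ -> _ ->.
- by move=> ? ? ? ? _ -> _ ->.
- by move=> ? ? _ ->.
- by move=> ? ? ? ? _ -> _ ->.
- by move=> ? ? _ ->.
- by move=> *; rewrite addrA.
- by move=> *; rewrite addrC.
- by move=> *; rewrite rmorph0 add0r.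
- by move=> *; rewrite rmorph0 addNr.
- by move=> *; rewrite mulrA.
- by move=> *; rewrite mulrC.
- by move=> *; rewrite rmorph1 mul1r.
- by move=> *; rewrite mulrDl.
- by move=> *; rewrite eexp_morph.
- by move=> *; rewrite rmorphD.
- by move=> *; rewrite rmorphM.
Qed.

Section ExpPoly.
Variables (K : eRingType) (n : nat).

Definition eterm_eqb (t u : eterm K n) : bool := `[< eterm_eq t u >].

Lemma eterm_eqb_refl : reflexive eterm_eqb.
Proof. by move=> t; apply/asboolP; apply: ete_refl. Qed.

Lemma eterm_eqb_sym : ssrbool.symmetric eterm_eqb.
Proof. by move=> t u; apply/asboolP/asboolP; apply: ete_sym. Qed.

Lemma eterm_eqb_trans : transitive eterm_eqb.
Proof.
by move=> u t v /asboolP tu /asboolP uv; apply/asboolP; apply: ete_trans uv.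
Qed.

Canonical eterm_equiv :=
  EquivRel eterm_eqb eterm_eqb_refl eterm_eqb_sym eterm_eqb_trans.

Definition expoly := {eq_quot eterm_equiv}.
HB.instance Definition _ := Choice.on expoly.
HB.instance Definition _ := EqQuotient.on expoly.

Lemma expoly_eqP (t u : eterm K n) :
  eterm_eq t u <-> \pi_expoly t = \pi_expoly u.
Proof.
split=> [tu | /eqmodP /asboolP //].
by apply/eqmodP; apply/asboolP.
Qed.

Lemma repr_pi (t : eterm K n) : eterm_eq (repr (\pi_expoly t)) t.
Proof. by apply/expoly_eqP; rewrite reprK. Qed.

Definition epC (c : K) : expoly := \pi_expoly (ETConst c).
Definition epX (i : 'I_n) : expoly := \pi_expoly (ETVar i).
Definition ep_add (p q : expoly) : expoly := \pi_expoly (ETAdd (repr p) (repr q)).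
Definition ep_opp (p : expoly) : expoly := \pi_expoly (ETOpp (repr p)).
Definition ep_mul (p q : expoly) : expoly := \pi_expoly (ETMul (repr p) (repr q)).
Definition ep_exp (p : expoly) : expoly := \pi_expoly (ETExp (repr p)).

Lemma pi_add t u : ep_add (\pi_expoly t) (\pi_expoly u) = \pi_expoly (ETAdd t u).
Proof. by apply/expoly_eqP; apply: ete_add; apply: repr_pi. Qed.
Lemma pi_opp t : ep_opp (\pi_expoly t) = \pi_expoly (ETOpp t).
Proof. by apply/expoly_eqP; apply: ete_opp; apply: repr_pi. Qed.
Lemma pi_mul t u : ep_mul (\pi_expoly t) (\pi_expoly u) = \pi_expoly (ETMul t u).
Proof. by apply/expoly_eqP; apply: ete_mul; apply: repr_pi. Qed.
Lemma pi_exp t : ep_exp (\pi_expoly t) = \pi_expoly (ETExp t).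
Proof. by apply/expoly_eqP; apply: ete_exp; apply: repr_pi. Qed.

Lemma expolyW (P : expoly -> Prop) : (forall t, P (\pi_expoly t)) -> forall p, P p.
Proof. by move=> Ppi p; rewrite -[p]reprK. Qed.

Lemma ep_addA : associative ep_add.
Proof.
elim/expolyW=> t; elim/expolyW=> u; elim/expolyW=> v.
by rewrite !pi_add; apply/expoly_eqP; apply: ete_addA.
Qed.

Lemma ep_addC : commutative ep_add.
Proof.
elim/expolyW=> t; elim/expolyW=> u.
by rewrite !pi_add; apply/expoly_eqP; apply: ete_addC.
Qed.

Lemma ep_add0 : left_id (epC 0) ep_add.
Proof.
by elim/expolyW=> t; rewrite !pi_add; apply/expoly_eqP; apply: ete_add0.
Qed.

Lemma ep_addN : left_inverse (epC 0) ep_opp ep_add.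
Proof.
by elim/expolyW=> t; rewrite pi_opp pi_add; apply/expoly_eqP; apply: ete_addN.
Qed.

Lemma ep_mulA : associative ep_mul.
Proof.
elim/expolyW=> t; elim/expolyW=> u; elim/expolyW=> v.
by rewrite !pi_mul; apply/expoly_eqP; apply: ete_mulA.
Qed.

Lemma ep_mulC : commutative ep_mul.
Proof.
elim/expolyW=> t; elim/expolyW=> u.
by rewrite !pi_mul; apply/expoly_eqP; apply: ete_mulC.
Qed.

Lemma ep_mul1 : left_id (epC 1) ep_mul.
Proof.
by elim/expolyW=> t; rewrite !pi_mul; apply/expoly_eqP; apply: ete_mul1.
Qed.

Lemma ep_mulDl : left_distributive ep_mul ep_add.
Proof.
elim/expolyW=> t; elim/expolyW=> u; elim/expolyW=> v.
by rewrite pi_add !pi_mul pi_add; apply/expoly_eqP; apply: ete_mulDl.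
Qed.

Lemma epC_inj : injective epC.
Proof.
move=> c d /expoly_eqP cd.
exact: (@etval_eq K K n idfun (fun=> erefl) (fun=> 0) _ _ cd).
Qed.

Lemma ep_1_neq0 : epC 1 != epC 0.
Proof. by rewrite (inj_eq epC_inj) oner_neq0. Qed.

HB.instance Definition _ :=
  GRing.isZmodule.Build expoly ep_addA ep_addC ep_add0 ep_addN.
HB.instance Definition _ :=
  GRing.Zmodule_isComNzRing.Build expoly
    ep_mulA ep_mulC ep_mul1 ep_mulDl ep_1_neq0.

Lemma ep_expD (p q : expoly) : ep_exp (p + q) = ep_exp p * ep_exp q.
Proof.
elim/expolyW: p => t; elim/expolyW: q => u.
rewrite [X in ep_exp X]pi_add !pi_exp [RHS]pi_mul.
by apply/expoly_eqP; apply: ete_expD.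
Qed.

Lemma ep_exp0 : ep_exp 0 = 1.
Proof.
rewrite [X in ep_exp X]/(epC 0) pi_exp.
apply: etrans (_ : epC (eexp 0) = 1); last by rewrite eexp0.
by apply/expoly_eqP; apply/ete_sym/ete_constE.
Qed.

HB.instance Definition _ := hasExp.Build expoly ep_exp0 ep_expD.

Lemma epC_exp c : epC (eexp c) = eexp (epC c).
Proof. by rewrite [RHS]pi_exp; apply/expoly_eqP; apply: ete_constE. Qed.

Lemma epCD c d : epC (c + d) = epC c + epC d.
Proof. by rewrite [RHS]pi_add; apply/expoly_eqP; apply: ete_constD. Qed.

Lemma epCM c d : epC (c * d) = epC c * epC d.
Proof. by rewrite [RHS]pi_mul; apply/expoly_eqP; apply: ete_constM. Qed.

HB.instance Definition _ := GRing.isNmodMorphism.Build K expoly epC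
  (conj (erefl : epC 0 = 0) epCD).
HB.instance Definition _ := GRing.isMonoidMorphism.Build K expoly epC
  (conj (erefl : epC 1 = 1) epCM).

Definition ep_lift (S : eRingType) (phi : K -> S) (s : 'I_n -> S)
  (p : expoly) : S := etval phi s (repr p).

Definition ep_eval (a : 'rV[K]_n) (p : expoly) : K :=
  ep_lift idfun (fun i => a 0 i) p.

(* Universal property: [ep_lift phi s] is the unique morphism of E-rings that *)
(* extends phi and maps each X_i to [s i].                                    *)
Section Lift.
Variables (S : eRingType) (phi : {rmorphism K -> S}).
Hypothesis phiE : forall c, phi (eexp c) = eexp (phi c).
Variable s : 'I_n -> S.

Lemma ep_lift_pi t : ep_lift phi s (\pi_expoly t) = etval phi s t.
Proof. by apply: etval_eq => //; apply: repr_pi. Qed.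

Lemma ep_liftC c : ep_lift phi s (epC c) = phi c.
Proof. exact: ep_lift_pi. Qed.

Lemma ep_liftX i : ep_lift phi s (epX i) = s i.
Proof. exact: ep_lift_pi. Qed.

Lemma ep_liftD p q :
  ep_lift phi s (p + q) = ep_lift phi s p + ep_lift phi s q.
Proof. exact: ep_lift_pi. Qed.

Lemma ep_liftM p q :
  ep_lift phi s (p * q) = ep_lift phi s p * ep_lift phi s q.
Proof. exact: ep_lift_pi. Qed.

Lemma ep_liftE p : ep_lift phi s (eexp p) = eexp (ep_lift phi s p).
Proof. exact: ep_lift_pi. Qed.

Lemma ep_lift_unique (f : {rmorphism expoly -> S}) :
    (forall p, f (eexp p) = eexp (f p)) -> (forall c, f (epC c) = phi c) ->
    (forall i, f (epX i) = s i) ->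
  f =1 ep_lift phi s.
Proof.
move=> fE fC fX; elim/expolyW => t; rewrite ep_lift_pi.
elim: t => //= [t IHt u IHu | t IHt | t IHt u IHu | t IHt].
- by rewrite -pi_add rmorphD IHt IHu.
- by rewrite -pi_opp rmorphN IHt.
- by rewrite -pi_mul rmorphM IHt IHu.
- by rewrite -pi_exp fE IHt.
Qed.

End Lift.
End ExpPoly.

Section Geometry.
Variable K : fieldType.

Inductive subfield_gen (A : K -> Prop) : K -> Prop :=
| sg_in x : A x -> subfield_gen A x
| sg_1 : subfield_gen A 1
| sg_sub x y : subfield_gen A x -> subfield_gen A y -> subfield_gen A (x - y)
| sg_div x y : subfield_gen A x -> subfield_gen A y -> subfield_gen A (x / y).

Definition mpoly_over (A : seq K) N (f : {mpoly K[N]}) : Prop :=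
  forall m, subfield_gen (fun x => x \in A) f@_m.

Definition mp_at N (f : {mpoly K[N]}) (x : 'rV[K]_N) : K :=
  f.@[fun i => x 0 i].

(* A point (z, y) of G_r = K^r * (K^* )^r is the row vector [row_mx z y].      *)
Definition in_G r (x : 'rV[K]_(r + r)) : Prop :=
  forall i, rsubmx x 0 i != 0.

Definition zeros_in_G r (F : {mpoly K[r + r]} -> Prop)
    (x : 'rV[K]_(r + r)) : Prop :=
  in_G x /\ forall f, F f -> mp_at f x = 0.

Definition closed_in_G r (V : 'rV[K]_(r + r) -> Prop) : Prop :=
  exists F, forall x, V x <-> zeros_in_G F x.

Definition closed_in_G_over (A : seq K) r (V : 'rV[K]_(r + r) -> Prop) : Prop :=
  exists2 F, forall f, F f -> mpoly_over A f
           & forall x, V x <-> zeros_in_G F x.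

Definition irreducible_in_G r (V : 'rV[K]_(r + r) -> Prop) : Prop :=
  [/\ closed_in_G V, exists x, V x &
      forall W1 W2 : 'rV[K]_(r + r) -> Prop,
        closed_in_G W1 -> closed_in_G W2 ->
        (forall x, V x -> W1 x \/ W2 x) ->
        (forall x, V x -> W1 x) \/ (forall x, V x -> W2 x)].

(* The dimension of the Zariski closure of S, as the transcendence degree     *)
(* over K of its coordinate ring: [dim_ge S d] says that d polynomial         *)
(* functions on S are algebraically independent over K.                       *)
Definition dim_ge N (S : 'rV[K]_N -> Prop) (d : nat) : Prop :=
  exists f : 'I_d -> {mpoly K[N]},
    forall P : {mpoly K[d]},
      (forall x, S x -> P.@[fun i => mp_at (f i) x] = 0) -> P = 0.

Definition has_dim N (S : 'rV[K]_N -> Prop) (d : nat) : Prop :=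
  dim_ge S d /\ ~ dim_ge S d.+1.

Definition brack r a (C : 'M[int]_(r, a)) (x : 'rV[K]_(a + a)) :
    'rV[K]_(r + r) :=
  row_mx (\row_i \sum_j (C i j)%:~R * lsubmx x 0 j)
         (\row_i \prod_j rsubmx x 0 j ^ C i j).

Definition brack_image r a (C : 'M[int]_(r, a)) (V : 'rV[K]_(a + a) -> Prop)
    (y : 'rV[K]_(r + r)) : Prop :=
  exists2 x, V x & y = brack C x.

Definition rotund a (V : 'rV[K]_(a + a) -> Prop) : Prop :=
  forall (r : nat) (C : 'M[int]_(r, a)),
    (1 <= r <= a)%N -> \rank (map_mx (intr : int -> rat) C) = r ->
    dim_ge (brack_image C V) r.

Definition free_in_G a (V : 'rV[K]_(a + a) -> Prop) : Prop :=
  ~ exists (m : 'rV[int]_a) (b : K), m != 0 /\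
      ((forall x, V x -> \prod_i rsubmx x 0 i ^ m 0 i = b) \/
       (forall x, V x -> \sum_i (m 0 i)%:~R * lsubmx x 0 i = b)).

(* For V closed, irreducible and defined over A, x is generic in V over A.    *)
Definition generic_over (A : seq K) r (V : 'rV[K]_(r + r) -> Prop)
    (x : 'rV[K]_(r + r)) : Prop :=
  V x /\ forall f, mpoly_over A f -> mp_at f x = 0 ->
         forall y, V y -> mp_at f y = 0.

Definition Q_lin_indep m (z : 'I_m -> K) : Prop :=
  forall q : 'I_m -> rat,
    \sum_i ratr (q i) * z i = 0 -> forall i, q i = 0.

Definition Q_alg_indep m (z : 'I_m -> K) : Prop :=
  forall P : {mpoly rat[m]}, (map_mpoly ratr P).@[z] = 0 -> P = 0.

Definition trdegQ_ge (F : K -> Prop) (m : nat) : Prop :=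
  exists2 z : 'I_m -> K, forall i, F (z i) & Q_alg_indep z.

End Geometry.

Definition countable_pred T (S : T -> Prop) : Prop :=
  exists e : nat -> option T, forall x, S x -> exists k, e k = Some x.

Section Zilber.
Variable K : eFieldType.

Definition exp_graph a (x : 'rV[K]_a) : 'rV[K]_(a + a) :=
  row_mx x (map_mx eexp x).

Definition infinite_cyclic_kernel : Prop :=
  exists2 tau : K, tau != 0 &
    forall x, eexp x = 1 <-> exists k : int, x = tau *~ k.

Definition schanuel_property : Prop :=
  forall (m : nat) (z : 'I_m -> K), Q_lin_indep z ->
    trdegQ_ge
      (subfield_gen (fun x => exists i, x = z i \/ x = eexp (z i))) m.

(* Zilber's axiom, with points generic over a given finite set of parameters; *)
(* enlarging A shows that there are infinitely many such points if 0 < a.     *)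
Definition strong_exp_closed : Prop :=
  forall (a : nat) (V : 'rV[K]_(a + a) -> Prop) (A : seq K),
    closed_in_G_over A V -> irreducible_in_G V -> rotund V -> free_in_G V ->
    exists x : 'rV[K]_a, generic_over A V (exp_graph x).

Definition countable_closure : Prop :=
  forall (a : nat) (V : 'rV[K]_(a + a) -> Prop) (A : seq K),
    closed_in_G_over A V -> irreducible_in_G V -> rotund V -> free_in_G V ->
    has_dim V a ->
    countable_pred (fun x : 'rV[K]_a => generic_over A V (exp_graph x)).

Record zilber_field : Prop := {
  zf_alg_closed : GRing.closed_field_axiom K;
  zf_exp_surj : forall y : K, y != 0 -> exists x, eexp x = y;
  zf_exp_ker : infinite_cyclic_kernel;
  zf_schanuel : schanuel_property;
  zf_countable_closure : countable_closure;
  zf_strong_exp_closed : strong_exp_closed;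
  zf_continuum : exists f : K -> (nat -> bool), bijective f
}.

End Zilber.

(* Main.v *)
(* Build p from finitely many nested exponentials y_j = exp(z_j), where z_j   *)
(* is a Laurent polynomial in x and the earlier y_k; splitting z_j into       *)
(* rational multiples makes the z_j linearly independent over Q modulo K, and *)
(* p becomes a Laurent polynomial in (x, y).  If it is a monomial in y, then  *)
(* p is an exponential.  Otherwise let y_0 be the last variable it involves,  *)
(* F the field of rational functions in the others, and E = F[y_0]/(P) for an *)
(* irreducible factor P of p over F that is not y_0.  The K-closure V of the  *)
(* point (z, y) of E is irreducible, and rotund because in echelon form one   *)
(* of the additive coordinates of [C](z, y) is independent of all but one of  *)
(* its multiplicative ones (a Jacobian computation).  If V is free, a point   *)
(* of V on the graph of exp is a zero of p.  If it is not, some monomial y^w  *)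
(* with w_0 != 0 is constant on V; after y_j -> y_j^m (j != 0) p vanishes on  *)
(* y_0 = c y^M, i.e. when a linear combination of the z_j takes a value d     *)
(* with exp d = c, and this is an equation with fewer variables y_j.          *)
Require Import Defs.
From HB Require Import structures.
From mathcomp Require Import all_boot all_order all_algebra all_field.
From mathcomp Require Import boolp.
From mathcomp Require Import mpoly.
From mathcomp Require Import ring.

Set Implicit Arguments.
Unset Strict Implicit.
Unset Printing Implicit Defensive.

Import Order.TTheory GRing.Theory.
Local Open Scope ring_scope.

(** * Polynomials in several variables *)

(** Read from the inside out, p is a Laurent polynomial t in the variables x_i and in exponentials
    y_j = exp(z_j), where z_j is itself Laurent in x and the earlier y_k ([represented_all]).
    Rational relations modulo K among the z_j are removed on the way by passing to roots of the y_j
    ([represented_exp]). If t were a monomial in y with a nonzero coefficient in K, p would be an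
    exponential, because exp maps onto the nonzero elements of K. So t is not a monomial, and
    [exp_zero] finds a zero by induction on the number of y_j that may occur in t.

    For the last such variable y_b, [zero_trichotomy] views t as a polynomial in y_b over a field of
    rational functions. Either it is a single power of y_b times a coefficient, and y_b can be set
    to 1; or it has a nonzero root rho in an algebraic extension. In that case let V be the locus
    over K of (z, y) with y_b = rho. V is irreducible and rotund ([locus_rotund], from
    [rank_log_jacobian]), and no integer combination of the z_j is constant on it. If no monomial in
    y is constant on V either, V is free, and exponential closedness gives a point of V on the graph
    of exp, hence a zero of t ([good_case]). If some monomial is constant, t vanishes on a coset y_b
    = c / y^M after extracting roots ([coset_case]). To reach that coset it is enough to solve a
    linear equation in the z_j with right-hand side a logarithm d of c. This equation no longer
    contains y_b. Two logarithms of c that differ by a generator of the kernel cannot both make it a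
    monomial ([shift_monomial_const]), so the induction hypothesis applies to one of them.

    Geometry is done with places: [specializable] supplies points of V at which finitely many chosen
    functions are defined. *)

Lemma mpoly_ring_ind n (R : nzRingType) (P : {mpoly R[n]} -> Prop) :
    (forall c, P c%:MP) -> (forall i, P 'X_i) ->
    (forall p q, P p -> P q -> P (p + q)) ->
    (forall p q, P p -> P q -> P (p * q)) ->
  forall p, P p.
Proof.
move=> PC PX PD PM; elim/mpolyind => [|c m p _ _ IHp].
  by rewrite -mpolyC0.
apply: (PD _ _ _ IHp); rewrite -mul_mpolyC; apply: (PM) => //.
rewrite mpolyXE_id; elim/big_rec: _ => [|i q _ Pq]; first by rewrite -mpolyC1.
apply: (PM) => //; elim: (m i) => [|k IHk]; first by rewrite expr0 -mpolyC1.
by rewrite exprS; apply: (PM).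
Qed.

Lemma rmorph_mmap n (R : nzRingType) (S T : comNzRingType)
    (f : {rmorphism R -> S}) (g : {rmorphism S -> T}) (h : 'I_n -> S) p :
  g (mmap f h p) = mmap (g \o f) (g \o h) p.
Proof.
elim/mpoly_ring_ind: p => [c|i|p q IHp IHq|p q IHp IHq].
- by rewrite !mmapC.
- by rewrite !mmapX !mmap1U.
- by rewrite !mmapD rmorphD IHp IHq.
- by rewrite !rmorphM /= IHp IHq.
Qed.

Lemma eq_mmap n (R S : nzRingType) (f g : R -> S) (h k : 'I_n -> S) :
  f =1 g -> h =1 k -> mmap f h =1 mmap g k.
Proof.
move=> fg hk p; rewrite /mmap; apply: eq_bigr => m _; rewrite fg.
by congr (_ * _); apply: eq_bigr => i _; rewrite hk.
Qed.

Definition is_derivation (K S : comNzRingType) (phi : K -> S) (D : S -> S) :=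
  [/\ forall x y, D (x + y) = D x + D y,
      forall x y, D (x * y) = D x * y + x * D y
    & forall c, D (phi c) = 0].

Lemma derivation_mmap n (K S : comNzRingType) (phi : {rmorphism K -> S}) D
    (derD : is_derivation phi D) (h : 'I_n -> S) p :
  D (mmap phi h p) = \sum_i mmap phi h p^`M(i) * D (h i).
Proof.
case: derD => DD DM DC; elim/mpoly_ring_ind: p => [c|i|p q IHp IHq|p q IHp IHq].
- by rewrite mmapC DC big1 // => i _; rewrite mderivC mmap0 mul0r.
- rewrite mmapX mmap1U (bigD1 i) //= big1 ?addr0 => [|j ji].
    rewrite mderivX mnm1E eqxx scale1r.
    have -> : (U_(i) - U_(i) = 0 :> 'X_{1..n})%MM.
      by apply/mnmP => j; rewrite mnmBE subnn mnm0E.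
    by rewrite mmapX mmap11 mul1r.
  by rewrite mderivX mnm1E eq_sym (negbTE ji) scale0r mmap0 mul0r.
- rewrite mmapD DD IHp IHq -big_split /=; apply: eq_bigr => i _.
  by rewrite mderivD mmapD mulrDl.
- rewrite rmorphM /= DM IHp IHq mulr_suml mulr_sumr -big_split /=.
  apply: eq_bigr => i _; rewrite mderivM mmapD !rmorphM /=; ring.
Qed.

Section CharZero.
Variable K : fieldType.
Hypothesis char0 : [pchar K] =i pred0.

Lemma natr_eq0_pchar0 n : ((n%:R : K) == 0) = (n == 0%N).
Proof. exact: (pcharf0P K).1. Qed.

Lemma intr_eq0_pchar0 (k : int) : ((k%:~R : K) == 0) = (k == 0).
Proof.
case: k => k; first by rewrite -pmulrn natr_eq0_pchar0.
by rewrite NegzE rmorphN /= oppr_eq0 oppr_eq0 -pmulrn natr_eq0_pchar0.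
Qed.

Lemma mderiv_eq0 n (p : {mpoly K[n]}) :
  (forall i, p^`M(i) = 0) -> p = (p@_0)%:MP.
Proof.
move=> dp0; apply/mpolyP => m; rewrite mcoeffC.
have [->|m0] := eqVneq m 0%MM; first by rewrite mulr1.
rewrite mulr0; have [i mi] : exists i, m i != 0%N.
  apply/existsP; apply: contraNT m0; rewrite negb_exists => /forallP m0.
  by apply/eqP/mnmP => i; rewrite mnm0E; apply/eqP; have := m0 i; rewrite negbK.
have := congr1 (mcoeff (m - U_(i))%MM) (dp0 i); rewrite mcoeff_mderiv mcoeff0.
rewrite submK ?lep1mP // -mulr_natr => /eqP.
by rewrite mulf_eq0 natr_eq0_pchar0 /= orbF => /eqP.
Qed.

Lemma msize_mderiv_lt n (p : {mpoly K[n]}) i :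
  p^`M(i) != 0 -> (msize p^`M(i) < msize p)%N.
Proof.
move=> dp0; rewrite -(mlead_deg dp0).
set m := mlead _; have : m \in msupp p^`M(i) by apply: mlead_supp.
rewrite mcoeff_msupp mcoeff_mderiv => cm.
have : (m + U_(i))%MM \in msupp p.
  by rewrite mcoeff_msupp; apply: contraNneq cm => ->; rewrite mul0rn.
by move/msize_mdeg_lt; rewrite mdegD mdeg1 addn1.
Qed.

(* If p vanishes everywhere, so do its partial derivatives. *)
Lemma meval_eq0 n (p : {mpoly K[n]}) : (forall a, p.@[a] = 0) -> p = 0.
Proof.
elim: {p}(msize p) {-2}p (leqnn (msize p)) => [|k IHk] p sp p0.
  by apply/eqP; rewrite -msize_poly_eq0 -leqn0.
have pC : p = (p@_0)%:MP.
  2: by move: (p0 (fun=> 0)); rewrite pC mevalC => ->; rewrite mpolyC0.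
apply: mderiv_eq0 => i; apply/eqP/contraT => dp0; move: (dp0).
rewrite (IHk p^`M(i)) ?eqxx //; first by have := leq_trans (msize_mderiv_lt dp0) sp.
(* Restrict p to the line through a in direction i. The restriction q has the roots 0, 1, 2, ...,
   which are distinct in characteristic 0, so q = 0; its derivative at 0 is the i-th partial
   derivative of p at a. *)
move=> a; pose h j : {poly K} := (a j)%:P + (j == i)%:R *: 'X.
pose q := mmap polyC h p.
have q0 : q = 0.
  apply: (@roots_geq_poly_eq0 _ _ [seq k%:R | k <- iota 0 (size q)]).
  - apply/allP => _ /mapP[l _ ->]; apply/eqP; rewrite -horner_evalE.
    rewrite (rmorph_mmap _ (horner_eval l%:R)) -[RHS](p0 (fun j => (h j).[l%:R])).
    by apply: eq_mmap => // c /=; rewrite /horner_eval hornerC.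
  - rewrite map_inj_in_uniq ?iota_uniq // => x y _ _ /eqP.
    wlog lexy : x y / (x <= y)%N => [W|].
      by case/orP: (leq_total x y) => /W // {}W; rewrite eq_sym => /W.
    by rewrite eq_sym -subr_eq0 -natrB // natr_eq0_pchar0 subn_eq0 => yx;
       apply/eqP; rewrite eqn_leq lexy.
  - by rewrite size_map size_iota.
have derD : is_derivation polyC (@deriv K).
  split=> [x y|x y|c]; [exact: derivD | exact: derivM | exact: derivC].
have := derivation_mmap derD h p; rewrite -/q q0 deriv0.
move/(congr1 (horner_eval 0)); rewrite rmorph0 rmorph_sum /= (bigD1 i) //=.
rewrite big1 ?addr0 => [|j ji]; last first.
  rewrite /h (negbTE ji) scale0r addr0 derivC mulr0.
  by rewrite rmorph0.
rewrite /h eqxx scale1r derivD derivC derivX add0r mulr1 (rmorph_mmap _ (horner_eval 0)).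
move=> e; rewrite [RHS]e; apply: eq_mmap => [c /=|j /=]; first by rewrite /horner_eval hornerC.
by rewrite /horner_eval hornerD hornerC hornerZ hornerX mulr0 addr0.
Qed.

(** Applying each D c to a relation P(g) = 0 shows that the vector of partial derivatives of P at g
    kills the Jacobian matrix, hence is 0. The partial derivatives are thus relations of smaller
    size, so they vanish by induction, and P is a constant with value 0. *)
Lemma jacobian_criterion (E : fieldType) (iota : {rmorphism K -> E}) r M
    (g : 'I_r -> E) (D : 'I_M -> E -> E) :
    (forall c, is_derivation iota (D c)) ->
    row_free (\matrix_(i < r, c < M) D c (g i)) ->
  forall P : {mpoly K[r]}, mmap iota g P = 0 -> P = 0.
Proof.
move=> derD freeJ P.
elim: {P}(msize P) {-2}P (leqnn (msize P)) => [|k IHk] P sP P0.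
  by apply/eqP; rewrite -msize_poly_eq0 -leqn0.
have dP0 i : mmap iota g P^`M(i) = 0.
  pose v := \row_i mmap iota g P^`M(i).
  suff v0 : v = 0 by have := congr1 (fun w : 'rV_r => w 0 i) v0; rewrite !mxE.
  apply/eqP; rewrite -(mulmx_free_eq0 _ freeJ); apply/eqP/rowP => c; rewrite !mxE.
  have -> : \sum_j v 0 j * (\matrix_(i < r, c < M) D c (g i)) j c = D c (mmap iota g P).
    rewrite (derivation_mmap (derD c)); apply: eq_bigr => j _.
    by rewrite !mxE.
  by rewrite P0 -[X in D c X](rmorph0 iota); case: (derD c).
have PC : P = (P@_0)%:MP.
  apply: mderiv_eq0 => i; apply/eqP/contraT => dP.
  move: (dP); rewrite (IHk _ _ (dP0 i)) ?eqxx //.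
  by have := leq_trans (msize_mderiv_lt dP) sP.
move: P0; rewrite PC mmapC => /eqP; rewrite fmorph_eq0 => /eqP ->.
by rewrite mpolyC0.
Qed.

End CharZero.

(** * Hilbert's basis theorem *)

(* Induction on the number k of coordinates compared: beyond a bound B of the *)
(* k-th coordinates of a finite basis for the first k ones, that basis also   *)
(* works for k+1, and below B there are finitely many slices.                 *)
Lemma dickson n (S : 'X_{1..n} -> Prop) :
  exists2 ms : seq 'X_{1..n}, forall m, m \in ms -> S m
    & forall m, S m -> exists2 m', m' \in ms & (m' <= m)%MM.
Proof.
suff H k : forall S : 'X_{1..n} -> Prop,
    exists2 ms : seq 'X_{1..n}, forall m, m \in ms -> S m &
      forall m, S m -> exists2 m', m' \in ms &
        forall i : 'I_n, (i < k)%N -> (m' i <= m i)%N.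
  have [ms msS msP] := H n S; exists ms => // m /msP[m' m'ms m'm].
  by exists m' => //; apply/mnm_lepP => i; apply: m'm.
elim: k => [|k IHk] {}S.
  have [[m Sm]|nS] := EM (exists m, S m).
    exists [:: m] => [m'|m' _]; first by rewrite inE => /eqP ->.
    by exists m; rewrite ?inE.
  by exists [::] => // m Sm; case: nS; exists m.
have [ltkn|lenk] := ltnP k n; last first.
  have [ms msS msP] := IHk S; exists ms => // m /msP[m' m'ms m'm].
  by exists m' => // i _; apply: m'm; apply: leq_trans (ltn_ord i) lenk.
pose ik := Ordinal ltkn; have [ms msS msP] := IHk S.
pose B := \max_(m <- ms) m ik.
have /choice[F FP] v : exists F : seq 'X_{1..n},
    (forall m, m \in F -> S m /\ m ik = v) /\
    forall m, S m /\ m ik = v -> exists2 m', m' \in F &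
      forall i : 'I_n, (i < k)%N -> (m' i <= m i)%N.
  by have [F FS FM] := IHk (fun m => S m /\ m ik = v); exists F.
exists (ms ++ flatten [seq F v | v <- iota 0 B]) => [m|m Sm].
  rewrite mem_cat => /orP[/msS//|/flatten_mapP[v _ mF]].
  by case: (FP v) => FS _; case: (FS _ mF).
have [leBm|ltmB] := leqP B (m ik).
  have [m' m'ms m'm] := msP m Sm; exists m'; first by rewrite mem_cat m'ms.
  move=> i; rewrite ltnS leq_eqVlt => /orP[/eqP ik'|]; last exact: m'm.
  have -> : i = ik by apply: val_inj.
  by apply: leq_trans leBm; rewrite /B (big_rem m') //= leq_maxl.
case: (FP (m ik)) => FS FM; have [m' m'F m'm] := FM m (conj Sm erefl).
exists m'.
  rewrite mem_cat; apply/orP; right; apply/flatten_mapP; exists (m ik) => //.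
  by rewrite mem_iota.
move=> i; rewrite ltnS leq_eqVlt => /orP[/eqP ik'|]; last exact: m'm.
have -> : i = ik by apply: val_inj.
by case: (FS _ m'F) => _ ->.
Qed.

Definition mpoly_ideal n (K : fieldType) (I : {mpoly K[n]} -> Prop) :=
  [/\ I 0, forall f g, I f -> I g -> I (f - g) & forall f g, I g -> I (f * g)].

(** Take elements of I whose leading monomials form a Dickson basis of all leading monomials of I.
    Subtracting a multiple of one of them lowers the leading monomial of f, so induction on that
    monomial applies. Generation by fs is expressed through the ideals J that contain fs. *)
Lemma hilbert_basis n (K : fieldType) (I : {mpoly K[n]} -> Prop) :
    mpoly_ideal I ->
  exists2 fs : seq {mpoly K[n]}, forall f, f \in fs -> I f
    & forall J, mpoly_ideal J -> (forall f, f \in fs -> J f) ->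
      forall f, I f -> J f.
Proof.
case=> I0 IB IM.
have [ms msS msP] := dickson (fun m => exists f, [/\ I f, f != 0 & mlead f = m]).
have /choice[F FP] m : exists f, m \in ms -> [/\ I f, f != 0 & mlead f = m].
  have [mms|_] := boolP (m \in ms); last by exists 0.
  by have [f ?] := msS m mms; exists f.
exists [seq F m | m <- ms] => [f /mapP[m mms ->]|J [J0 JB JM] FJ].
  by have [] := FP m mms.
elim/mleadrect => f IHf If.
have [->//|f0] := eqVneq f 0.
have [|m mms mf] := msP (mlead f); first by exists f.
have [IF F0 leadF] := FP m mms.
pose h := (mleadc f / mleadc (F m)) *: 'X_[mlead f - m] * F m.
have Jh : J h by apply: JM; apply: FJ; apply: map_f.
have Ih : I h by apply: IM.
have cF0 : mleadc (F m) != 0 by rewrite mleadc_eq0.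
have cf0 : mleadc f != 0 by rewrite mleadc_eq0.
have leadh : mlead h = mlead f.
  rewrite /h mleadM ?scaler_eq0 ?negb_or ?mulf_neq0 ?invr_eq0 //=; last first.
    by rewrite -msize_poly_eq0 msizeX.
  by rewrite mleadZ ?mulf_neq0 ?invr_eq0 // mleadXm leadF submK.
have coefh : h@_(mlead f) = mleadc f.
  rewrite -[in LHS]leadh /h mleadM ?scaler_eq0 ?negb_or ?mulf_neq0 ?invr_eq0 //=; last first.
    by rewrite -msize_poly_eq0 msizeX.
  rewrite mleadcM mleadZ ?mulf_neq0 ?invr_eq0 // mleadXm mcoeffZ mcoeffX eqxx.
  by rewrite mulr1 divfK.
have -> : f = (f - h) - (0 - h) by ring.
apply: (JB) _ (JB _ _ J0 Jh).
have [->//|fh0] := eqVneq (f - h) 0.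
apply: IHf; last exact: IB.
rewrite lt_neqAle; apply/andP; split; last first.
  by apply: le_trans (mleadB_le _ _) _; rewrite leadh joinxx.
apply: contra_neq fh0 => eq_lead; apply/eqP; rewrite -mleadc_eq0 eq_lead.
by rewrite mcoeffB coefh subrr.
Qed.

(** * Places and derivations *)

(* The graph of a ring morphism from a subring of E to L. *)
Record is_place (E L : fieldType) (G : E -> L -> Prop) : Prop := {
  place1 : G 1 1;
  placeB : forall x y a b, G x a -> G y b -> G (x - y) (a - b);
  placeM : forall x y a b, G x a -> G y b -> G (x * y) (a * b);
  place0_eq0 : forall a, G 0 a -> a = 0
}.

Section Place.
Variables (E L : fieldType) (G : E -> L -> Prop).
Hypothesis plG : is_place G.

Lemma place0 : G 0 0.
Proof. by have := placeB plG (place1 plG) (place1 plG); rewrite !subrr. Qed.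

Lemma placeN x a : G x a -> G (- x) (- a).
Proof. by move/(placeB plG place0); rewrite !sub0r. Qed.

Lemma placeD x y a b : G x a -> G y b -> G (x + y) (a + b).
Proof. by move=> Gx /placeN /(placeB plG Gx); rewrite !opprK. Qed.

Lemma place_sum I (r : seq I) (P : pred I) f g :
  (forall i, P i -> G (f i) (g i)) ->
  G (\sum_(i <- r | P i) f i) (\sum_(i <- r | P i) g i).
Proof. by move=> Gfg; elim/big_rec2: _ => [|i y x /Gfg]; [exact: place0|exact: placeD]. Qed.

Lemma place_prod I (r : seq I) (P : pred I) f g :
  (forall i, P i -> G (f i) (g i)) ->
  G (\prod_(i <- r | P i) f i) (\prod_(i <- r | P i) g i).
Proof.
move=> Gfg; elim/big_rec2: _ => [|i y x /Gfg]; first exact: (place1 plG).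
exact: (placeM plG).
Qed.

Lemma placeX x a n : G x a -> G (x ^+ n) (a ^+ n).
Proof.
by move=> Gx; elim: n => [|n]; rewrite ?expr0 ?exprS; [exact: place1|exact: placeM].
Qed.

Lemma place_fun x a b : G x a -> G x b -> a = b.
Proof.
move=> Ga Gb; apply/eqP; rewrite -subr_eq0; apply/eqP/(place0_eq0 plG).
by rewrite -(subrr x); apply: placeB.
Qed.

(** The device for keeping a quantity nonzero under specialization: require the place to be defined
    at its inverse as well. *)
Lemma placeV x a b : x != 0 -> G x a -> G x^-1 b -> a != 0 /\ b = a^-1.
Proof.
move=> x0 Ga Gb; have := placeM plG Ga Gb; rewrite divff // => /place_fun.
move/(_ _ (place1 plG)) => ab1.
have a0 : a != 0.
  by apply: contra_eq_neq ab1 => ->; rewrite mul0r eq_sym oner_neq0.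
by split=> //; apply: (mulfI a0); rewrite ab1 divff.
Qed.

Lemma place_expz x a (k : int) :
  x != 0 -> G x a -> G x^-1 a^-1 -> G (x ^ k) (a ^ k).
Proof.
move=> x0 Ga Gb; case: k => k; first exact: placeX.
by rewrite !NegzE -!exprz_inv; apply: placeX.
Qed.

Lemma place_mmap n (R : nzRingType) (f : {rmorphism R -> E})
    (g : {rmorphism R -> L}) (h : 'I_n -> E) (k : 'I_n -> L) p :
  (forall c, G (f c) (g c)) -> (forall i, G (h i) (k i)) ->
  G (mmap f h p) (mmap g k p).
Proof.
move=> Gfg Ghk; rewrite /mmap; apply: place_sum => m _.
by apply: (placeM plG) => //; apply: place_prod => i _; apply: placeX.
Qed.

Definition poly_place (q : {poly E}) (r : {poly L}) := forall i, G q`_i r`_i.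

Lemma poly_placeB q r q' r' :
  poly_place q r -> poly_place q' r' -> poly_place (q - q') (r - r').
Proof. by move=> Gq Gq' i; rewrite !coefB; apply: placeB. Qed.

Lemma poly_placeM q r q' r' :
  poly_place q r -> poly_place q' r' -> poly_place (q * q') (r * r').
Proof.
move=> Gq Gq' i; rewrite !coefM; apply: place_sum => j _; exact: placeM.
Qed.

Lemma poly_placeZXn q r x a n : G x a ->
  poly_place q r -> poly_place (x *: 'X^n * q) (a *: 'X^n * r).
Proof.
move=> Gx Gq i; rewrite -!scalerAl !coefZ !coefXnM; apply: placeM => //.
by case: ifP => // _; apply: place0.
Qed.

Lemma poly_placeD q r q' r' :
  poly_place q r -> poly_place q' r' -> poly_place (q + q') (r + r').
Proof. by move=> Gq Gq' i; rewrite !coefD; apply: placeD. Qed.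

Lemma poly_place_lift (q : {poly E}) :
  (forall i, exists a, G q`_i a) -> exists r, poly_place q r.
Proof.
move=> /choice[f Gf]; exists (\poly_(i < size q) f i) => i; rewrite coef_poly.
by case: ltnP => // lei; rewrite nth_default //; apply: place0.
Qed.

Lemma poly_place_monic p r : p \is monic -> poly_place p r ->
  r \is monic /\ size r = size p.
Proof.
move=> monp Gpr; have p0 := monic_neq0 monp.
have lead1 : r`_(size p).-1 = 1.
  by apply: (place_fun (Gpr _)); rewrite -lead_coefE (eqP monp); apply: place1.
have szr : size r = size p.
  apply/eqP; rewrite eqn_leq; apply/andP; split.
    apply/leq_sizeP => j lej; apply: (place0_eq0 plG).
    by have := Gpr j; rewrite nth_default.
  rewrite -(prednK (_ : 0 < size p)%N) ?size_poly_gt0 //.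
  rewrite ltnNge; apply/negP => /(nth_default 0) e.
  by move: lead1; rewrite e => /eqP; rewrite eq_sym oner_eq0.
by split=> //; rewrite monicE lead_coefE szr lead1.
Qed.

(** Division by a monic polynomial never divides coefficients, so the same steps can be carried out
    on both sides of G. *)
Lemma poly_place_div p p' q r : p \is monic -> poly_place p p' ->
    poly_place q r ->
  exists h h' u u', [/\ poly_place h h', poly_place u u', q = h * p + u,
    r = h' * p' + u' & (size u < size p)%N].
Proof.
move=> monp Gp; elim: {q}(size q) {-2}q (leqnn (size q)) r => [|n IHn] q szq r Gq.
  exists 0, 0, q, r; rewrite !mul0r !add0r; split=> //.
    by move=> i; rewrite !coef0; apply: place0.
  by rewrite (leq_ltn_trans szq) // size_poly_gt0 monic_neq0.
have [ltqp|lepq] := ltnP (size q) (size p).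
  exists 0, 0, q, r; rewrite !mul0r !add0r; split=> //.
  by move=> i; rewrite !coef0; apply: place0.
pose d := (size q - size p)%N; pose x := q`_(size q).-1; pose a := r`_(size q).-1.
have Gx : G x a by apply: Gq.
pose q1 := q - x *: 'X^d * p; pose r1 := r - a *: 'X^d * p'.
have Gq1 : poly_place q1 r1 by apply: poly_placeB => //; apply: poly_placeZXn.
have q0 : (0 < size q)%N by rewrite (leq_trans _ lepq) // size_poly_gt0 monic_neq0.
have p0 : (0 < size p)%N by rewrite size_poly_gt0 monic_neq0.
have szq1 : (size q1 <= n)%N.
  have : (size q1 <= (size q).-1)%N; last by move/leq_trans; apply; rewrite -ltnS prednK.
  apply/leq_sizeP => j lej; rewrite coefB -scalerAl coefZ coefXnM.
  have dle : (d <= (size q).-1)%N by rewrite -ltnS prednK // ltn_subrL p0.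
  have -> : (j < d)%N = false by rewrite ltnNge (leq_trans dle).
  have [ejq|nejq] := eqVneq j (size q).-1.
    rewrite ejq; have -> : ((size q).-1 - d = (size p).-1)%N.
      by rewrite -subn1 -subnDA addnC subnDA subKn // subn1.
    by rewrite -(lead_coefE p) (eqP monp) mulr1 subrr.
  have ltqj : (size q <= j)%N by rewrite -(prednK q0) ltn_neqAle eq_sym nejq.
  rewrite (nth_default _ (_ : size p <= j - d)%N) ?mulr0 ?subr0; last first.
    by rewrite -(subKn lepq) leq_sub2r.
  by rewrite nth_default.
have [h [h' [u [u' [Gh Gu eq er szu]]]]] := IHn q1 szq1 r1 Gq1.
exists (h + x *: 'X^d), (h' + a *: 'X^d), u, u'; split=> //.
- apply: poly_placeD => // i; rewrite !coefZ !coefXn; apply: placeM => //.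
  by case: (i == d); [apply: place1|apply: place0].
- by rewrite mulrDl addrAC -eq /q1 subrK.
- by rewrite mulrDl addrAC -er /r1 subrK.
Qed.

Lemma poly_place_dvdp p p' q r : p \is monic -> poly_place p p' ->
  poly_place q r -> p %| q -> p' %| r.
Proof.
move=> monp Gp Gq pq.
have [h [h' [u [u' [Gh Gu eq er szu]]]]] := poly_place_div monp Gp Gq.
have u0 : u = 0.
  apply/eqP/contraT => u0; move: pq; rewrite eq dvdp_addr ?dvdp_mull //.
  by move/(dvdp_leq u0); rewrite leqNgt szu.
have u'0 : u' = 0.
  apply/polyP => i; rewrite coef0; apply: (place0_eq0 plG).
  by have := Gu i; rewrite u0 coef0.
by rewrite er u'0 addr0 dvdp_mull.
Qed.

End Place.

(** * Fraction fields: places and derivations *)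

Lemma fractionE (A : idomainType) (x : {fraction A}) :
  exists n d, d != 0 /\ x = FracField.tofrac n / FracField.tofrac d.
Proof.
elim/quotW: x => x; exists (frac x).1, (frac x).2; split; first exact: denom_ratioP.
have d0 : FracField.tofrac (frac x).2 != 0 by rewrite tofrac_eq0 denom_ratioP.
apply: (mulIf d0); rewrite divfK // !piE; unlock FracField.tofrac.
apply/eqP; apply: (etrans (FracField.equivf_def _ _)).
rewrite /FracField.mulf !numden_Ratio ?(oner_eq0, mulf_neq0, denom_ratioP) //.
by rewrite !mulr1 mulrC eqxx.
Qed.

Lemma fraction_field (A : idomainType) :
  exists (F : fieldType) (tf : {rmorphism A -> F}), injective tf /\
    forall x, exists n d, d != 0 /\ x = tf n / tf d.
Proof.
exists {fraction A}, (@FracField.tofrac A); split; last exact: fractionE.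
by move=> a b /eqP; rewrite tofrac_eq => /eqP.
Qed.

Section Fraction.
Variables (A : idomainType) (F : fieldType) (tf : {rmorphism A -> F}).
Hypothesis tf_inj : injective tf.
Hypothesis fractionP : forall x, exists n d, d != 0 /\ x = tf n / tf d.

Lemma tf_eq0 a : (tf a == 0) = (a == 0).
Proof. by rewrite -(inj_eq tf_inj) rmorph0. Qed.

Lemma fraction_common_denom (s : seq F) :
  exists2 e, e != 0 & forall x, x \in s -> exists n, x = (tf n) / (tf e).
Proof.
elim: s => [|x s [e e0 IHs]]; first by exists 1; rewrite ?oner_neq0.
have [n [d [d0 ->]]] := fractionP x.
exists (e * d) => [|y]; first by rewrite mulf_neq0.
rewrite inE => /orP[/eqP ->|/IHs[k ->]].
  by exists (n * e); rewrite !rmorphM /=; field; rewrite !tf_eq0 d0 e0.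
by exists (k * d); rewrite !rmorphM /=; field; rewrite !tf_eq0 d0 e0.
Qed.

Section FracPlace.
Variables (L : fieldType) (h : {rmorphism A -> L}).

(** The localization of A at the kernel of h, with the map to L that h induces on it. *)
Definition frac_place (x : F) (k : L) :=
  exists n d, [/\ h d != 0, x = (tf n) / (tf d) & k = h n / h d].

Lemma frac_placeP : is_place frac_place.
Proof.
have nz d : h d != 0 -> (tf d) != 0.
  by rewrite tf_eq0; apply: contraNneq => ->; rewrite rmorph0.
split.
- by exists 1, 1; rewrite !rmorph1 oner_neq0 !divr1.
- move=> _ _ _ _ [n [d [hd -> ->]]] [m [e [he -> ->]]].
  exists (n * e - m * d), (d * e); rewrite !rmorphB !rmorphM /= mulf_neq0 //.
  by split=> //; field; rewrite ?hd ?he ?(nz _ hd) ?(nz _ he).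
- move=> _ _ _ _ [n [d [hd -> ->]]] [m [e [he -> ->]]].
  exists (n * m), (d * e); rewrite !rmorphM /= mulf_neq0 //.
  by split=> //; field; rewrite ?hd ?he ?(nz _ hd) ?(nz _ he).
- move=> _ [n [d [hd /esym/eqP + ->]]]; rewrite mulf_eq0 invr_eq0.
  by rewrite (negbTE (nz _ hd)) orbF tf_eq0 => /eqP ->; rewrite rmorph0 mul0r.
Qed.

Lemma frac_place_tf a : frac_place (tf a) (h a).
Proof. by exists a, 1; rewrite !rmorph1 oner_neq0 !divr1. Qed.

End FracPlace.

(** The quotient rule, applied to a chosen representative of each fraction; [D'E] shows that the
    choice does not matter. *)
Lemma frac_derivation (K : comNzRingType) (phi : K -> A) (D : A -> A) :
    is_derivation phi D ->
  exists2 D' : F -> F,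
    is_derivation (fun c => (tf (phi c))) D' & forall a, D' (tf a) = (tf (D a)).
Proof.
case=> DD DM DC.
pose f (n d : A) := ((tf (D n)) * (tf d) - (tf n) * (tf (D d))) / (tf d) ^+ 2.
have /choice[nd ndP] (x : F) : exists nd : A * A,
    nd.2 != 0 /\ x = (tf nd.1) / (tf nd.2).
  by have [n [d]] := fractionP x; exists (n, d).
pose D' x := f (nd x).1 (nd x).2.
have D'E n d : d != 0 -> D' ((tf n) / (tf d)) = f n d.
  move=> d0; rewrite /D'; have [] := ndP ((tf n) / (tf d)).
  case: (nd _) => m e /= e0; have dF0 : (tf d) != 0 by rewrite tf_eq0.
  have eF0 : (tf e) != 0 by rewrite tf_eq0.
  move/eqP; rewrite eqr_div // -!rmorphM (inj_eq tf_inj) => /eqP ned.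
  have := congr1 (fun x => (tf (D x))) ned; rewrite !DM !rmorphD !rmorphM /= => Dned.
  have := congr1 tf ned; rewrite !rmorphM /= => nedF.
  have mE : (tf m) = (tf n) * (tf e) / (tf d) by rewrite nedF mulfK.
  have DmE : (tf (D m)) =
      ((tf (D n)) * (tf e) + (tf n) * (tf (D e)) - (tf m) * (tf (D d))) / (tf d).
    by rewrite Dned; field.
  by rewrite /f DmE mE; field; rewrite ?dF0 ?eF0.
have DF a : D' (tf a) = (tf (D a)).
  have D1 : D 1 = 0.
    by apply: (addrI (D 1)); rewrite addr0 -{3}(mulr1 1) DM mulr1 mul1r.
  rewrite -[(tf a)]divr1 -(rmorph1 tf) D'E ?oner_neq0 // /f D1 !rmorph0 !rmorph1.
  by rewrite mulr1 mulr0 subr0 expr1n divr1.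
exists D' => //; split=> [x y|x y|c]; last by rewrite DF DC rmorph0.
- have [n [d [d0 ->]]] := fractionP x; have [m [e [e0 ->]]] := fractionP y.
  have dF0 : (tf d) != 0 by rewrite tf_eq0.
  have eF0 : (tf e) != 0 by rewrite tf_eq0.
  have -> : (tf n) / (tf d) + (tf m) / (tf e) = (tf (n * e + m * d)) / (tf (d * e)).
    by rewrite rmorphD !rmorphM /=; field; rewrite ?dF0 ?eF0.
  rewrite !D'E ?mulf_neq0 // /f !(DD, DM) !(rmorphD, rmorphM) /=.
  by field; rewrite ?dF0 ?eF0.
- have [n [d [d0 ->]]] := fractionP x; have [m [e [e0 ->]]] := fractionP y.
  have dF0 : (tf d) != 0 by rewrite tf_eq0.
  have eF0 : (tf e) != 0 by rewrite tf_eq0.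
  have -> : (tf n) / (tf d) * ((tf m) / (tf e)) = (tf (n * m)) / (tf (d * e)).
    by rewrite !rmorphM /=; field; rewrite ?dF0 ?eF0.
  rewrite !D'E ?mulf_neq0 // /f !DM !(rmorphD, rmorphM) /=.
  by field; rewrite ?dF0 ?eF0.
Qed.

End Fraction.

Lemma mderiv_derivation n (K : fieldType) (i : 'I_n) :
  is_derivation (@mpolyC n K) (mderiv i).
Proof. by split=> [x y|x y|c]; rewrite ?mderivD ?mderivM ?mderivC. Qed.

(** A substitute for the Nullstellensatz: with the inverse of a nonzero e put into s, [placeV]
    yields a K-valued specialization at which e does not vanish. *)
Definition specializable (K E : fieldType) (iota : K -> E) :=
  forall s : seq E, exists G : E -> K -> Prop,
    [/\ is_place G, forall c, G (iota c) c
      & forall x, x \in s -> exists a, G x a].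

Lemma specializable_fraction n (K F : fieldType)
    (tf : {rmorphism {mpoly K[n]} -> F}) :
    [pchar K] =i pred0 -> injective tf ->
    (forall x, exists n d, d != 0 /\ x = tf n / tf d) ->
  specializable (fun c => tf c%:MP).
Proof.
move=> char0 tf_inj fractionP s.
have [e e0 sP] := fraction_common_denom tf_inj fractionP s.
have [a ea] : exists a, e.@[a] != 0.
  apply: contrapT => h; move/eqP: e0; apply; apply: (meval_eq0 char0) => a.
  by apply/eqP/negPn/negP => ea; apply: h; exists a.
exists (frac_place tf (meval a)); split=> [|c|x /sP[k ->]].
- exact: frac_placeP.
- by have := frac_place_tf tf (meval a) c%:MP; rewrite /= mevalC.
- by exists (k.@[a] / e.@[a]), k, e.
Qed.

(** * Simple algebraic extensions *)

Section SimpleExtension.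
Variables (F E : fieldType) (iota : {rmorphism F -> E}) (z : E) (P : {poly F}).
Hypothesis irrP : irreducible_poly P.
Hypothesis Pz : root (map_poly iota P) z.
Hypothesis genz : forall x, exists q, x = (map_poly iota q).[z].

Lemma dvdp_root_ext q : (map_poly iota q).[z] = 0 -> P %| q.
Proof.
move=> qz; apply/contraT => nPq.
have : coprimep P q.
  by move: nPq; rewrite irreducible_poly_coprime.
case/Bezout_eq1_coprimepP => [[u v]] /= /(congr1 (fun f => (map_poly iota f).[z])).
rewrite rmorphD !rmorphM /= hornerD !hornerM qz (rootP Pz) !mulr0 addr0.
by rewrite rmorph1 hornerC => /eqP; rewrite eq_sym oner_eq0.
Qed.

Lemma ext_place (L : fieldType) (G : F -> L -> Prop) P' rho :
    is_place G -> P \is monic -> poly_place G P P' -> root P' rho ->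
  is_place (fun x k => exists q r,
    [/\ poly_place G q r, x = (map_poly iota q).[z] & k = r.[rho]]).
Proof.
move=> plG monP GP P'r; split.
- exists 1, 1; rewrite rmorph1 !hornerC; split=> // i; rewrite !coef1.
  by case: (i == 0)%N; [exact: place1 | exact: place0].
- move=> _ _ _ _ [q [r [Gq -> ->]]] [q' [r' [Gq' -> ->]]].
  exists (q - q'), (r - r'); rewrite rmorphB /= !hornerE.
  by split=> //; apply: poly_placeB.
- move=> _ _ _ _ [q [r [Gq -> ->]]] [q' [r' [Gq' -> ->]]].
  exists (q * q'), (r * r'); rewrite rmorphM /= !hornerM.
  by split=> //; apply: poly_placeM.
- move=> _ [q [r [Gq /esym/dvdp_root_ext Pq ->]]].
  have /dvdpP[h ->] := poly_place_dvdp plG monP GP Gq Pq.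
  by rewrite hornerM (rootP P'r) mulr0.
Qed.

(** Write the elements of s as polynomials in z and specialize all their coefficients together with
    those of P. As P is monic, its image P' keeps its degree and has a root rho in K; z is sent to
    rho. *)
Lemma specializable_ext (K : fieldType) (phi : K -> F) :
    GRing.closed_field_axiom K -> P \is monic -> specializable phi ->
  specializable (fun c => iota (phi c)).
Proof.
move=> closedK monP specF s; have /choice[q qP] := genz.
have [G [plG GK Gs]] := specF ((P : seq F) ++ flatten [seq (q x : seq F) | x <- s]).
have lift (f : {poly F}) : {subset (f : seq F) <=
    (P : seq F) ++ flatten [seq (q x : seq F) | x <- s]} -> exists g, poly_place G f g.
  move=> fs; apply: (poly_place_lift plG) => i.
  have [lti|lei] := ltnP i (size f); first exact/Gs/fs/mem_nth.
  by exists 0; rewrite nth_default //; apply: place0.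
have [P' GP'] : exists P', poly_place G P P'.
  by apply: lift => c cP; rewrite mem_cat cP.
have [monP' szP'] := poly_place_monic plG monP GP'.
have [rho P'rho] : exists rho, root P' rho.
  have [] := closedK (size P').-1 (fun i => - P'`_i).
    by rewrite szP'; case: irrP => + _; case: (size P) => [|[]].
  move=> x xP; exists x; rewrite /root horner_coef.
  have -> : size P' = (size P').-1.+1 by rewrite prednK // size_poly_gt0 monic_neq0.
  rewrite big_ord_recr /= -lead_coefE (eqP monP') mul1r xP -big_split /=.
  by rewrite big1 // => i _; rewrite mulNr subrr.
exists (fun x k => exists q r,
    [/\ poly_place G q r, x = (map_poly iota q).[z] & k = r.[rho]]); split.
- exact: (ext_place plG monP GP').
- move=> c; exists (phi c)%:P, c%:P; rewrite map_polyC !hornerC; split=> // i.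
  by rewrite !coefC; case: (i == 0)%N => //; apply: place0.
- move=> x xs; have [r Gqr] : exists r, poly_place G (q x) r.
    apply: lift => c cq; rewrite mem_cat; apply/orP; right.
    by apply/flatten_mapP; exists x.
  by exists r.[rho], (q x), r; rewrite -qP.
Qed.

(** Differentiating P(z) = 0 forces the value [tau] on z. The resulting [delta] on polynomials kills
    P, so it is well defined modulo P, that is, on E. *)
Lemma derivation_ext (K : comNzRingType) (phi : K -> F) (D : F -> F) :
    [pchar F] =i pred0 -> is_derivation phi D ->
  exists2 D' : E -> E, is_derivation (fun c => iota (phi c)) D'
    & forall x, D' (iota x) = iota (D x).
Proof.
move=> char0 [DD DM DC].
have D0 : D 0 = 0 by apply: (addrI (D 0)); rewrite -DD !addr0.
have Dsum I (r : seq I) (f : I -> F) : D (\sum_(i <- r) f i) = \sum_(i <- r) D (f i).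
  by elim/big_rec2: _ => // i x y _ <-; rewrite DD.
pose pD := map_poly D; have pDE q i : (pD q)`_i = D q`_i by rewrite coef_map_id0.
have pDD q r : pD (q + r) = pD q + pD r.
  by apply/polyP => i; rewrite coefD !pDE coefD DD.
have pDM q r : pD (q * r) = pD q * r + q * pD r.
  apply/polyP => i; rewrite coefD pDE !coefM Dsum -big_split /=.
  by apply: eq_bigr => j _; rewrite DM !pDE.
pose ev q := (map_poly iota q).[z].
have evD q r : ev (q + r) = ev q + ev r by rewrite /ev rmorphD hornerD.
have evM q r : ev (q * r) = ev q * ev r by rewrite /ev rmorphM hornerM.
have evP : ev P = 0 by apply/rootP.
(* Separability: in characteristic 0 the derivative of P is nonzero and of smaller degree, so P
   cannot divide it. *)
have evP' : ev P^`() != 0.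
  apply/eqP => /dvdp_root_ext; have [P1 _] := irrP.
  have P0 : P != 0 by rewrite -size_poly_gt0 ltnW.
  have dP0 : P^`() != 0.
    apply/eqP => /(congr1 (fun f : {poly F} => f`_(size P).-2)).
    rewrite coef_deriv coef0 prednK; last by rewrite -ltnS prednK // ltnW.
    rewrite -lead_coefE -mulr_natr => /eqP.
    rewrite mulf_eq0 lead_coef_eq0 (negbTE P0) natr_eq0_pchar0 //=.
    by case: (size P) P1 => [|[]].
  by move/(dvdp_leq dP0); rewrite leqNgt lt_size_deriv.
pose tau := - ev (pD P) / ev P^`().
pose delta q := ev (pD q) + ev q^`() * tau.
have deltaD q r : delta (q + r) = delta q + delta r.
  by rewrite /delta pDD derivD !evD; ring.
have deltaM q r : delta (q * r) = delta q * ev r + ev q * delta r.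
  by rewrite /delta pDM derivM !(evD, evM); ring.
have deltaP : delta P = 0 by rewrite /delta /tau mulrC divfK // subrr.
have delta_eq q r : ev q = ev r -> delta q = delta r.
  move=> qr; have /dvdp_root_ext/dvdpP[h hE] : ev (q - r) = 0.
    by rewrite /ev rmorphB hornerD hornerN -!/(ev _) qr subrr.
  by rewrite -(subrK r q) hE deltaD deltaM deltaP evP !mulr0 !add0r.
have /choice[q qP] := genz.
have D'E r : delta (q (ev r)) = delta r by apply: delta_eq; rewrite /ev -qP.
have evC c : ev c%:P = iota c by rewrite /ev map_polyC hornerC.
have deltaC c : delta c%:P = iota (D c).
  rewrite /delta derivC [ev 0]/ev rmorph0 horner0 mul0r addr0 -evC; congr ev.
  by apply/polyP => i; rewrite pDE !coefC; case: (i == 0)%N.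
exists (fun x => delta (q x)) => [|x]; last by rewrite -evC D'E deltaC.
split=> [x y|x y|c].
- by rewrite -deltaD; apply: delta_eq; rewrite evD /ev -!qP.
- by rewrite {3}(qP x) {2}(qP y) -!/(ev _) -deltaM; apply: delta_eq; rewrite evM /ev -!qP.
- by rewrite -evC D'E deltaC DC rmorph0.
Qed.

End SimpleExtension.

Lemma simple_extension (F : fieldType) (P : {poly F}) : irreducible_poly P ->
  exists (E : fieldType) (iota : {rmorphism F -> E}) (z : E),
    root (map_poly iota P) z /\ forall x, exists q, x = (map_poly iota q).[z].
Proof.
move=> irrP; have [L _ [z Pz genz]] := irredp_FAdjoin irrP.
exists L, (in_alg L), z; split=> // x.
have : x \in <<1; z>>%VS by rewrite genz memvf.
case/Fadjoin_polyP => q /polyOver1P[r ->] ->; by exists r.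
Qed.

(** * Algebraically closed fields *)

Section ClosedField.
Variable K : fieldType.
Hypothesis closedK : GRing.closed_field_axiom K.

Lemma closed_field_root (p : {poly K}) : size p != 1%N -> exists x, root p x.
Proof.
have [->|p0] := eqVneq p 0; first by exists 0; rewrite root0.
move=> szp; have szp0 : (0 < size p)%N by rewrite size_poly_gt0.
have [|x xP] := closedK (n := (size p).-1) (fun i => - (p`_i / lead_coef p)).
  by case: (size p) szp szp0 => [|[]].
exists x; rewrite /root horner_coef -(prednK szp0) big_ord_recr /=.
rewrite -lead_coefE xP mulr_sumr -big_split /= big1 // => i _.
by rewrite mulNr mulrN mulrA mulrCA divff ?mulr1 ?lead_coef_eq0 // subrr.
Qed.

Lemma closed_field_rootn m (b : K) : (0 < m)%N -> exists r, r ^+ m = b.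
Proof.
move=> m0; have [|r] := @closed_field_root ('X^m - b%:P).
  by rewrite size_XnsubC // eqSS -lt0n.
by rewrite /root hornerD hornerN hornerXn hornerC subr_eq0 => /eqP; exists r.
Qed.

Lemma closed_field_split (p : {poly K}) : p \is monic ->
  exists rs : seq K, p = \prod_(r <- rs) ('X - r%:P).
Proof.
elim: {p}(size p) {-2}p (erefl (size p)) => [|n IHn] p szp monp.
  by move/monic_neq0: monp; rewrite -size_poly_eq0 szp.
have [e1|ne1] := eqVneq (size p) 1%N.
  exists [::]; rewrite big_nil; move/eqP/size_poly1P: e1 monp => [c _ ->].
  by rewrite monicE lead_coefC => /eqP ->.
have [x /factor_theorem[q qE]] := closed_field_root ne1.
have monq : q \is monic by move: monp; rewrite qE monicMr ?monicXsubC.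
have [|//|rs qrs] := IHn q.
  apply/eqP; rewrite -eqSS -szp qE size_Mmonic ?monic_neq0 ?monicXsubC //.
  by rewrite size_XsubC addn2.
by exists (x :: rs); rewrite big_cons mulrC qE {1}qrs.
Qed.

End ClosedField.

(** * Rotundity *)

Lemma rat_rmorphism (E : fieldType) : [pchar E] =i pred0 ->
  exists f : {rmorphism rat -> E}, True.
Proof.
move=> char0; pose f (x : rat) : E := (numq x)%:~R / (denq x)%:~R.
have nz_den x : (denq x)%:~R != 0 :> E by rewrite intr_eq0_pchar0 // denq_eq0.
have fE (a b : int) : b != 0 -> f (a%:~R / b%:~R) = a%:~R / b%:~R.
  move=> b0; have bE0 : b%:~R != 0 :> E by rewrite intr_eq0_pchar0.
  apply/eqP; rewrite eqr_div // -!rmorphM; apply/eqP; congr _%:~R.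
  apply: (@intr_inj rat); rewrite !rmorphM /= numqE.
  by rewrite mulrAC divfK ?intr_eq0.
have ratE (x : rat) : exists a b : int, b != 0 /\ x = a%:~R / b%:~R.
  by exists (numq x), (denq x); rewrite denq_eq0 divq_num_den.
have fB : zmod_morphism f.
  move=> x y; have [a [b [b0 ->]]] := ratE x; have [c [d [d0 ->]]] := ratE y.
  have -> : a%:~R / b%:~R - c%:~R / d%:~R = (a * d - c * b)%:~R / (b * d)%:~R :> rat.
    by rewrite rmorphB !rmorphM /=; field; rewrite !intr_eq0 d0 b0.
  rewrite !fE ?mulf_neq0 // rmorphB !rmorphM /=.
  by field; rewrite !intr_eq0_pchar0 // d0 b0.
have fM : monoid_morphism f.
  split=> [|x y]; first by rewrite /f divr1.
  have [a [b [b0 ->]]] := ratE x; have [c [d [d0 ->]]] := ratE y.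
  have -> : a%:~R / b%:~R * (c%:~R / d%:~R) = (a * c)%:~R / (b * d)%:~R :> rat.
    by rewrite !rmorphM /=; field; rewrite !intr_eq0 d0 b0.
  rewrite !fE ?mulf_neq0 // !rmorphM /=.
  by field; rewrite !intr_eq0_pchar0 // d0 b0.
pose f1 := GRing.isZmodMorphism.Build rat E f fB.
pose f2 := GRing.isMonoidMorphism.Build rat E f fM.
by exists (HB.pack f f1 f2 : {rmorphism rat -> E}).
Qed.

Lemma rat_row_clear_denom n (w : 'rV[rat]_n) :
  exists2 d : int, d != 0 & exists v : 'I_n -> int, forall j, d%:~R * w 0 j = (v j)%:~R.
Proof.
exists (\prod_j denq (w 0 j)); first by apply/prodf_neq0 => j _; rewrite denq_eq0.
exists (fun j => numq (w 0 j) * \prod_(k | k != j) denq (w 0 k)) => j.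
by rewrite (bigD1 j) //= !rmorphM /= numqE; ring.
Qed.

Lemma row_free_rowsub (F : fieldType) m n p (A : 'M[F]_(m, n)) (f : 'I_p -> 'I_m) :
  injective f -> row_free A -> row_free (rowsub f A).
Proof.
move=> f_inj freeA.
have -> : rowsub f A = rowsub f 1%:M *m A by rewrite mul_rowsub_mx mul1mx.
rewrite /row_free mxrankMfree //; apply/eqP.
apply/eqP; rewrite -/(row_free _); apply/row_freeP; exists (rowsub f 1%:M)^T.
apply/matrixP => i j; rewrite !mxE (bigD1 (f i)) //= big1 => [|k ki].
  by rewrite !mxE eqxx addr0 mul1r eq_sym (inj_eq f_inj).
by rewrite !mxE eq_sym (negbTE ki) mul0r.
Qed.

Section Rank.
Variables (E : fieldType) (r a M : nat).
Hypothesis char0 : [pchar E] =i pred0.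
Variables (C : 'M[int]_(r, a)) (Lam Phi : 'M[E]_(a, M)).
Variables (t : 'I_a) (kappa : 'I_a -> 'I_M) (ell : 'I_a -> E).
Hypothesis ell_neq0 : forall k, ell k != 0.
Hypothesis LamE : forall j k, j != t -> k != t ->
  Lam j (kappa k) = (j == k)%:R * ell k.
Hypothesis PhiE : forall j k : 'I_a, (j <= k)%N -> k != t -> Phi j (kappa k) = 0.
Hypothesis Phi_free : forall w : 'I_a -> int, (exists j, w j != 0) ->
  exists c, \sum_j (w j)%:~R * Phi j c != 0.

(* Let W be the row space of C, W' its subspace with t-th coordinate 0 and w  *)
(* a nonzero vector of W (of W' if possible) whose last nonzero coordinate    *)
(* comes as early as possible.  Then w Phi lives in columns where no nonzero  *)
(* element of W' Lam can live.                                                *)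
Lemma rank_log_jacobian : (0 < r)%N -> \rank (map_mx (intr : int -> rat) C) = r ->
  (r <= \rank (col_mx (map_mx intr C *m Phi) (map_mx intr C *m Lam)))%N.
Proof.
move=> r_gt0 rankC; have [f _] := rat_rmorphism char0.
set CQ := map_mx _ C in rankC; set J := col_mx _ _.
have CE : map_mx intr C = map_mx f CQ.
  by apply/matrixP => i j; rewrite !mxE /= rmorph_int.
have Phi_inj (w : 'rV[rat]_a) : w != 0 -> map_mx f w *m Phi != 0.
  move=> w0; have [d d0 [v vE]] := rat_row_clear_denom w.
  have [|c vc] := Phi_free (w := v).
    have [j wj] : exists j, w 0 j != 0.
      by move/eqP: w0 => w0; apply: contrapT => h; apply: w0; apply/rowP => j;
        rewrite mxE; apply/eqP/negPn/negP => wj; apply: h; exists j.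
    exists j; rewrite -(intr_eq0 rat) -vE mulf_neq0 // intr_eq0 //.
  apply: contraNneq vc => /(congr1 (fun A : 'rV_M => d%:~R * A 0 c)).
  rewrite !mxE mulr0 mulr_sumr => sum0; apply/eqP; rewrite -[RHS]sum0.
  apply: eq_bigr => j _; rewrite mxE mulrA; congr (_ * _).
  by have := congr1 f (vE j); rewrite rmorphM !rmorph_int => <-.
pose dt : 'cV[rat]_a := delta_mx t 0.
(* A single linear condition lowers the dimension by at most one, so W' has rank at least r - 1. *)
pose W' := (CQ :&: kermx dt)%MS; pose B := row_base W'.
have Bt : B *m dt = 0.
  by apply/sub_kermxP; rewrite eq_row_base capmxSr.
have rankW' : (r <= (\rank W').+1)%N.
  have := mxrank_mul_ker CQ dt; rewrite rankC -/W' => <-.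
  by rewrite -[X in (_ <= X)%N]add1n leq_add2r rank_leq_col.
have freeB : row_free B := row_base_free W'.
have Bt0 (x : 'rV[E]_(\rank W')) : (x *m map_mx f B) 0 t = 0.
  have : x *m map_mx f B *m map_mx f dt = 0.
    by rewrite -mulmxA -map_mxM Bt map_mx0 mulmx0.
  move/(congr1 (fun A : 'M_1 => A 0 0)); rewrite mxE [RHS]mxE => <-.
  rewrite (bigD1 t) //= big1 => [|k kt]; last by rewrite !mxE (negbTE kt) rmorph0 mulr0.
  by rewrite !mxE !eqxx rmorph1 mulr1 addr0.
(* On W' the t-th coordinate is 0, so in the columns [kappa k] the matrix [Lam] only scales the k-th
   coordinate. Hence B Lam already has full rank. *)
have BLam (x : 'rV[E]_(\rank W')) k : k != t ->
    (x *m map_mx f B *m Lam) 0 (kappa k) = (x *m map_mx f B) 0 k * ell k.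
  move=> kt; set v := x *m _; rewrite mxE (bigD1 k) //= big1 ?addr0 => [|j jk].
    by rewrite LamE // eqxx mul1r.
  have [->|jt] := eqVneq j t; first by rewrite Bt0 mul0r.
  by rewrite LamE // (negbTE jk) mul0r mulr0.
have BLam_free : row_free (map_mx f B *m Lam).
  apply/inj_row_free => x; rewrite mulmxA => xBL.
  have : x *m map_mx f B = 0.
    apply/rowP => k; rewrite [RHS]mxE; have [->|kt] := eqVneq k t; first exact: Bt0.
    apply: (mulIf (ell_neq0 k)); rewrite mul0r -BLam //.
    by rewrite xBL mxE.
  by move/eqP; rewrite mulmx_free_eq0 ?row_free_map // => /eqP.
(* One further dimension is missing: w Phi is nonzero by [Phi_inj] and has to lie outside the row
   space of B Lam. *)
suff [w [wC w0 wB]] : exists w : 'rV[rat]_a, [/\ (w <= CQ)%MS, w != 0 &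
    forall x : 'rV[E]_(\rank W'), x *m map_mx f B *m Lam = map_mx f w *m Phi -> x = 0].
  have BJ : (map_mx f B *m Lam + map_mx f w *m Phi <= J)%MS.
    rewrite addsmx_sub; apply/andP; split.
      have [Y ->] : exists Y, B = Y *m CQ.
        by apply/submxP; rewrite eq_row_base capmxSl.
      by rewrite map_mxM -CE -mulmxA (submx_trans (submxMl _ _)) // /J -addsmxE addsmxSr.
    have /submxP[Y ->] := wC.
    by rewrite map_mxM -CE -mulmxA (submx_trans (submxMl _ _)) // /J -addsmxE addsmxSl.
  apply: leq_trans (mxrankS BJ); apply: (leq_trans rankW').
  have := BLam_free; rewrite /row_free => /eqP {1}<-; apply: rank_ltmx.
  rewrite ltmxE addsmxSl /= addsmx_sub submx_refl /=; apply/negP => /submxP[x xE].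
  have x0 : x = 0 by apply: wB; rewrite xE mulmxA.
  by have := Phi_inj _ w0; rewrite xE x0 mul0mx eqxx.
have [W'0|W'n0] := eqVneq W' 0.
  have [i Ci] : exists i, row i CQ != 0.
    apply: contrapT => h; move: r_gt0; rewrite -rankC.
    have -> : CQ = 0; last by rewrite mxrank0.
    apply/row_matrixP => i; rewrite row0; apply/eqP/negPn/negP => Ci.
    by apply: h; exists i.
  exists (row i CQ); split=> //; first exact: row_sub.
  by move=> x _; apply/rowP => j; have := ltn_ord j; rewrite {2}W'0 mxrank0.
pose P m := exists w : 'rV[rat]_a, [/\ w != 0, (w <= W')%MS &
  forall k : 'I_a, (m <= k)%N -> w 0 k = 0].
have exP : exists m, `[< P m >].
  exists a; apply/asboolP; exists (nz_row W'); rewrite nz_row_eq0 W'n0 nz_row_sub.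
  by split=> // k; rewrite leqNgt ltn_ord.
case: (ex_minnP exP) => m /asboolP[w [w0 wW' wm]] minm.
exists w; split=> //; first by apply: submx_trans wW' (capmxSl _ _).
have m_gt0 : (0 < m)%N.
  by rewrite lt0n; apply: contraNneq w0 => m0; apply/eqP/rowP => k; rewrite wm ?m0 // mxE.
(* By minimality of m, a nonzero element of W' has a nonzero coordinate at some k >= m.-1.
   Truncation to these coordinates is therefore injective on W', and, stated as row freeness, this
   survives the passage from rat to E. *)
pose S : 'M[rat]_a := diag_mx (\row_k (m.-1 <= k)%N%:R).
have freeBS : row_free (B *m S).
  apply/inj_row_free => y; rewrite mulmxA => yBS.
  have yB0 : y *m B = 0.
    apply/eqP/negPn/negP => yB; have : `[< P m.-1 >].
      apply/asboolP; exists (y *m B); split=> //.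
        by rewrite (submx_trans (submxMl _ _)) // eq_row_base.
      move=> k mk; move/(congr1 (fun A : 'rV_a => A 0 k)): yBS.
      by rewrite mul_mx_diag !mxE mk mulr1.
    by move/minm; rewrite -ltnS prednK // ltnn.
  by move/eqP: yB0; rewrite mulmx_free_eq0 // => /eqP.
move=> x xE; have : x *m map_mx f (B *m S) = 0; last first.
  by move/eqP; rewrite mulmx_free_eq0 ?row_free_map // => /eqP.
rewrite map_mxM mulmxA map_diag_mx mul_mx_diag; apply/rowP => k; rewrite !mxE.
case: leqP => mk; last by rewrite rmorph0 mulr0.
rewrite rmorph1 mulr1; have [->|kt] := eqVneq k t; first by have := Bt0 x; rewrite mxE.
apply: (mulIf (ell_neq0 k)); rewrite mul0r.
(* In column [kappa k] every term of w Phi vanishes: for j <= k the entry of Phi is 0, and j > k >=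
   m.-1 gives w_j = 0. *)
have := BLam x k kt; rewrite [in X in _ = X]mxE => <-; rewrite xE mxE big1 // => j _.
have [lejk|ltkj] := leqP j k; first by rewrite PhiE ?mulr0.
rewrite mxE wm ?rmorph0 ?mul0r //; apply: leq_trans ltkj; by rewrite -(prednK m_gt0) ltnS.
Qed.

End Rank.

(** * Points on the graph of exponentiation *)

Section LogDerivative.
Variables (K E : fieldType) (iota : {rmorphism K -> E}) (D : E -> E).
Hypothesis derD : is_derivation iota D.

Lemma derivation_intr_mul (k : int) x : D (k%:~R * x) = k%:~R * D x.
Proof.
case: derD => _ DM DC; rewrite DM -(rmorph_int iota) DC mul0r add0r.
by rewrite rmorph_int.
Qed.

Lemma derivation_sum I (s : seq I) (P : pred I) (f : I -> E) :
  D (\sum_(i <- s | P i) f i) = \sum_(i <- s | P i) D (f i).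
Proof.
case: derD => DD _ DC; elim/big_rec2: _ => [|i x y _ <-]; last exact: DD.
by rewrite -(rmorph0 iota) DC rmorph0.
Qed.

Lemma derivation1 : D 1 = 0.
Proof. by case: derD => _ _ DC; rewrite -(rmorph1 iota) DC. Qed.

Lemma log_derivM x y : x != 0 -> y != 0 ->
  D (x * y) / (x * y) = D x / x + D y / y.
Proof. by move=> x0 y0; case: derD => _ -> _; field; rewrite x0 y0. Qed.

Lemma log_derivV x : x != 0 -> D x^-1 / x^-1 = - (D x / x).
Proof.
move=> x0; apply: (addrI (D x / x)); rewrite -log_derivM ?invr_eq0 //.
by rewrite divff // derivation1 mul0r subrr.
Qed.

Lemma log_derivX x n : x != 0 -> D (x ^+ n) / x ^+ n = n%:R * (D x / x).
Proof.
move=> x0; elim: n => [|n IHn]; first by rewrite expr0 derivation1 !mul0r.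
by rewrite exprS log_derivM ?expf_neq0 // IHn -[in RHS]natr1; ring.
Qed.

Lemma log_deriv_expz x (k : int) : x != 0 -> D (x ^ k) / x ^ k = k%:~R * (D x / x).
Proof.
move=> x0; case: k => n; first exact: log_derivX.
rewrite NegzE -exprz_inv; have := log_derivX n.+1 (_ : x^-1 != 0).
by rewrite invr_eq0 => /(_ x0); rewrite log_derivV // => ->; rewrite rmorphN /=; ring.
Qed.

Lemma log_deriv_prod I (s : seq I) (f : I -> E) : (forall i, f i != 0) ->
  D (\prod_(i <- s) f i) / \prod_(i <- s) f i = \sum_(i <- s) D (f i) / f i.
Proof.
move=> f0; elim: s => [|i s IHs]; first by rewrite !big_nil derivation1 mul0r.
rewrite !big_cons log_derivM // ?IHs //.
by elim: (s) => [|j u IHu]; rewrite ?big_nil ?oner_neq0 // big_cons mulf_neq0.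
Qed.

End LogDerivative.

Section GenericPoint.
Variables (K : eFieldType) (E : fieldType) (iota : {rmorphism K -> E}).
Variables (a M : nat) (t : 'I_a) (zh yh : 'I_a -> E).
Variables (D : 'I_M -> E -> E) (kappa : 'I_a -> 'I_M).
Hypothesis specE : specializable iota.
Hypothesis yh_neq0 : forall j, yh j != 0.
Hypothesis derD : forall c, is_derivation iota (D c).
Hypothesis D_yh : forall j k, j != t -> k != t -> D (kappa k) (yh j) = (j == k)%:R.
Hypothesis D_zh : forall j k : 'I_a, (j <= k)%N -> k != t -> D (kappa k) (zh j) = 0.
Hypothesis zh_free : forall w : 'I_a -> int, (exists j, w j != 0) ->
  exists c, \sum_j (w j)%:~R * D c (zh j) != 0.
Hypothesis yh_free : forall (w : 'I_a -> int) b, (exists j, w j != 0) ->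
  \prod_j yh j ^ w j != iota b.

Let char0K : [pchar K] =i pred0 := pchar0.
Let char0E : [pchar E] =i pred0.
Proof. by move=> p; rewrite (fmorph_pchar iota) char0K. Qed.

Definition generic_point (i : 'I_(a + a)) : E :=
  match split i with inl j => zh j | inr j => yh j end.

Definition locus (x : 'rV[K]_(a + a)) : Prop :=
  in_G x /\ forall f, mmap iota generic_point f = 0 -> mp_at f x = 0.

Lemma locus_point (s : seq E) : exists (G : E -> K -> Prop) x,
  [/\ is_place G, locus x, forall c, G (iota c) c,
      forall j, G (zh j) (lsubmx x 0 j) &
      forall j, G (yh j) (rsubmx x 0 j) /\ G (yh j)^-1 (rsubmx x 0 j)^-1] /\
  forall e, e \in s -> exists b, G e b.
Proof.
(* The inverses of the y-coordinates are included so that the specialized point stays in the torus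
   part of G. *)
have [G [plG GK Gs]] := specE (s ++ [seq generic_point i | i : 'I_(a + a)]
  ++ [seq (yh j)^-1 | j : 'I_a]).
have /choice[x Gx] i : exists x, G (generic_point i) x.
  by apply: Gs; rewrite !mem_cat map_f ?mem_enum ?orbT.
exists G, (\row_i x i); have Gy j : G (yh j) (rsubmx (\row_i x i) 0 j).
  by have := Gx (rshift a j); rewrite !mxE /generic_point (unsplitK (inr j)).
have Gyv j : rsubmx (\row_i x i) 0 j != 0 /\ G (yh j)^-1 (rsubmx (\row_i x i) 0 j)^-1.
  have [b Gb] : exists b, G (yh j)^-1 b.
    by apply: Gs; rewrite !mem_cat; apply/orP; right; apply/orP; right;
      apply/mapP; exists j; rewrite ?mem_enum.
  by have [y0 <-] := placeV plG (yh_neq0 j) (Gy j) Gb.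
split; last by move=> e es; apply: Gs; rewrite mem_cat es.
split=> // [|j|j]; [split=> [j|f fE]| |].
- by case: (Gyv j).
- apply: (place0_eq0 plG); rewrite -fE /mp_at; apply: (place_mmap plG) => // i.
  by rewrite mxE.
- by have := Gx (lshift a j); rewrite !mxE /generic_point (unsplitK (inl j)).
- by split; [exact: Gy | case: (Gyv j)].
Qed.

(** The exponential closedness axiom wants V over a finite parameter set; the coefficients of a
    finite basis of the vanishing ideal of the generic point provide one. *)
Lemma locus_closed : exists A, closed_in_G_over A locus.
Proof.
have idI : mpoly_ideal (fun f => mmap iota generic_point f = 0).
  split=> [|f g fE gE|f g gE]; first by rewrite rmorph0.
    by rewrite rmorphB /= fE gE subrr.
  by rewrite rmorphM /= gE mulr0.
have [fs fsI fsP] := hilbert_basis idI.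
exists (flatten [seq [seq f@_m | m <- msupp f] | f : {mpoly K[a + a]} <- fs]).
exists (fun f => f \in fs) => [f ffs m|x].
  have [mf|/memN_msupp_eq0 ->] := boolP (m \in msupp f).
    by apply: sg_in; apply/flatten_mapP; exists f => //; apply: map_f.
  by rewrite -(subrr 1); apply: sg_sub; apply: sg_1.
split=> [[Gx xP]|[Gx xP]]; split=> // f; first by move/fsI/xP.
apply: (fsP (fun f => mp_at f x = 0)) => //; rewrite /mp_at.
split=> [|g h gE hE|g h hE]; first by rewrite rmorph0.
  by rewrite rmorphB /= gE hE subrr.
by rewrite rmorphM /= hE mulr0.
Qed.

(** If V is contained in neither closed set, each has an equation that is nonzero at the generic
    point. A specialization defined at the inverse of the product of the two values gives a point of
    V outside both sets. *)
Lemma locus_irreducible : irreducible_in_G locus.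
Proof.
have [A [F _ VF]] := locus_closed; split; first by exists F.
  by have [G [x [[]]]] := locus_point [::]; exists x.
move=> W1 W2 [F1 W1F] [F2 W2F] VW.
have pick_fun (W : 'rV_(a + a) -> Prop) F' : (forall x, W x <-> zeros_in_G F' x) ->
    ~ (forall x, locus x -> W x) ->
    exists2 f, F' f & mmap iota generic_point f != 0.
  move=> WF nVW; apply: contrapT => h; apply: nVW => x [Gx xP]; apply/WF.
  split=> // f Ff; apply: xP; apply/eqP/negPn/negP => fn0; apply: h.
  by exists f.
have [|nV1] := EM (forall x, locus x -> W1 x); first by left.
have [|nV2] := EM (forall x, locus x -> W2 x); first by right.
have [f1 Ff1 f1n0] := pick_fun _ _ W1F nV1.
have [f2 Ff2 f2n0] := pick_fun _ _ W2F nV2.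
have [G [x [[plG Vx GK Gz Gy] Gs]]] :=
  locus_point [:: (mmap iota generic_point (f1 * f2))^-1].
have [|b Gb] := Gs (mmap iota generic_point (f1 * f2))^-1; first by rewrite inE.
have Gf : G (mmap iota generic_point (f1 * f2)) (mp_at (f1 * f2) x).
  apply: (place_mmap plG) => // i; rewrite /generic_point.
  case: splitP => j ij; first by have := Gz j; rewrite mxE; congr (G _ (x 0 _)); apply: val_inj.
  by have [+ _] := Gy j; rewrite mxE; congr (G _ (x 0 _)); apply: val_inj.
have [|+ _] := placeV plG _ Gf Gb; first by rewrite rmorphM mulf_neq0.
rewrite /mp_at rmorphM /= mulf_eq0 negb_or => /andP[f1x f2x].
case: (VW x Vx) => [/W1F[_ /(_ _ Ff1)]|/W2F[_ /(_ _ Ff2)]] /eqP.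
  by rewrite /mp_at (negbTE f1x).
by rewrite /mp_at (negbTE f2x).
Qed.

(** A relation on V must already hold at the generic point, since otherwise some point of V violates
    it. There [yh_free] excludes the multiplicative ones, and the additive ones are excluded because
    some D c does not kill the combination of the zh j. *)
Lemma locus_free : free_in_G locus.
Proof.
case=> m [b [m0 mb]]; have mj : exists j, m 0 j != 0.
  apply: contrapT => h; move/eqP: m0; apply; apply/rowP => j; rewrite mxE.
  by apply/eqP/negPn/negP => mj; apply: h; exists j.
case: mb => Vb.
- pose e := \prod_j yh j ^ m 0 j - iota b.
  have [G [x [[plG Vx GK Gz Gy] Gs]]] := locus_point [:: e^-1].
  have [|b' Gb'] := Gs e^-1; first by rewrite inE.
  have e0 : e != 0 by rewrite subr_eq0 yh_free.
  have Ge : G e (\prod_j rsubmx x 0 j ^ m 0 j - b).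
    apply: (placeB plG) => //; apply: (place_prod plG) => j _.
    by have [Gyj Gyvj] := Gy j; apply: place_expz.
  by have [] := placeV plG e0 Ge Gb'; rewrite Vb // subrr eqxx.
- pose e := \sum_j (m 0 j)%:~R * zh j - iota b.
  have [G [x [[plG Vx GK Gz Gy] Gs]]] := locus_point [:: e^-1].
  have [|b' Gb'] := Gs e^-1; first by rewrite inE.
  have e0 : e != 0.
    have [c] := zh_free mj; apply: contra_neq => /eqP; rewrite subr_eq0 => /eqP E0.
    have [_ _ Dc] := derD c; rewrite -[RHS](Dc b) -E0 (derivation_sum (derD c)).
    by apply: eq_bigr => j _; rewrite (derivation_intr_mul (derD c)).
  have Ge : G e (\sum_j (m 0 j)%:~R * lsubmx x 0 j - b).
    apply: (placeB plG) => //; apply: (place_sum plG) => j _.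
    by apply: (placeM plG) => //; rewrite -(rmorph_int iota); exact: GK.
  by have [] := placeV plG e0 Ge Gb'; rewrite Vb // subrr eqxx.
Qed.

(** Up to nonzero row factors, the Jacobian of the image g of the generic point under [C] is the
    matrix of [rank_log_jacobian], of rank at least r. So r coordinates of g are algebraically
    independent over K, and a nonzero polynomial in them is nonzero at some specialized point of the
    image. *)
Lemma locus_rotund : rotund locus.
Proof.
move=> r C /andP[r_gt0 _] rankC.
pose u i := \sum_j (C i j)%:~R * zh j; pose v i := \prod_j yh j ^ C i j.
pose g (i : 'I_(r + r)) := match split i with inl j => u j | inr j => v j end.
pose Phi := \matrix_(j < a, c < M) D c (zh j).
pose Lam := \matrix_(j < a, c < M) (D c (yh j) / yh j).
pose J := col_mx (map_mx intr C *m Phi) (map_mx intr C *m Lam).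
have v0 i : v i != 0 by apply/prodf_neq0 => j _; rewrite expfz_neq0.
have rankJ : (r <= \rank J)%N.
  apply: (@rank_log_jacobian E r a M char0E C Lam Phi t kappa (fun k => (yh k)^-1)) => //.
  - by move=> k; rewrite invr_eq0.
  - move=> j k jt kt; rewrite mxE D_yh //.
    by case: eqVneq => [->|_]; rewrite ?mul0r.
  - by move=> j k jk kt; rewrite mxE D_zh.
  - move=> w /zh_free[c wc]; exists c; move: wc.
    by congr (_ != 0); apply: eq_bigr => j _; rewrite mxE.
pose w (i : 'I_r) := widen_ord rankJ i; pose k i := maxrankfun J (w i).
have w_inj : injective w by move=> i j /(congr1 val) ij; apply: val_inj.
have freeJ : row_free (rowsub w (rowsub (maxrankfun J) J)).
  by apply: row_free_rowsub => //; apply: maxrowsub_free.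
(* The lower block of J holds logarithmic derivatives, so D c (v j) differs from the entry of J by
   the factor v j. *)
pose lam (i : 'I_(r + r)) : E := match split i with inl _ => 1 | inr j => v j end.
have lam0 i : lam i != 0 by rewrite /lam; case: split => // _; apply: oner_neq0.
have Jg i c : D c (g i) = lam i * J i c.
  rewrite /g /lam mxE; case: splitP => j _; rewrite mxE.
    rewrite mul1r (derivation_sum (derD c)); apply: eq_bigr => l _.
    by rewrite (derivation_intr_mul (derD c)) !mxE.
  apply: (mulIf (invr_neq0 (v0 j))); rewrite [RHS]mulrAC divff // mul1r.
  rewrite (log_deriv_prod (derD c)) => [|l]; last by rewrite expfz_neq0.
  by apply: eq_bigr => l _; rewrite (log_deriv_expz (derD c)) // !mxE.
have freeDg : row_free (\matrix_(i < r, c < M) D c (g (k i))).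
  apply/inj_row_free => x xD.
  have : \row_i (x 0 i * lam (k i)) = 0; last first.
    move=> xl; apply/rowP => i; rewrite [RHS]mxE; apply: (mulIf (lam0 (k i))).
    by rewrite mul0r; have := congr1 (fun y : 'rV_r => y 0 i) xl; rewrite !mxE.
  apply/eqP; rewrite -(mulmx_free_eq0 _ freeJ) -xD; apply/eqP/rowP => c.
  rewrite !mxE; apply: eq_bigr => i _; rewrite !mxE Jg mulrA.
  by congr (_ * _); rewrite mxE.
have indep := jacobian_criterion char0K derD freeDg.
exists (fun i => 'X_(k i)) => P P0; apply: contrapT => /eqP Pn0.
have e0 : mmap iota (g \o k) P != 0.
  by apply: contra_neq Pn0 => /indep.
have [G [x [[plG Vx GK Gz Gy] Gs]]] := locus_point [:: (mmap iota (g \o k) P)^-1].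
have [|b Gb] := Gs (mmap iota (g \o k) P)^-1; first by rewrite inE.
have Gg i : G (g i) (brack C x 0 i).
  rewrite /g mxE; case: splitP => j _; rewrite mxE.
    apply: (place_sum plG) => l _; apply: (placeM plG); last exact: Gz.
    by rewrite -(rmorph_int iota); apply: GK.
  apply: (place_prod plG) => l _.
  by have [Gyl Gyvl] := Gy l; apply: place_expz.
have GP : G (mmap iota (g \o k) P) (P.@[fun i => brack C x 0 (k i)]).
  by rewrite /meval; apply: (place_mmap plG) => [c|i]; [exact: GK|exact: Gg].
have [/eqP PC _] := placeV plG e0 GP Gb; apply: PC.
rewrite -[RHS](P0 (brack C x)); last by exists x.
by apply: meval_eq => i; rewrite /mp_at mevalXU.
Qed.

Lemma generic_point_on_exp_graph : strong_exp_closed K ->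
  exists z : 'rV[K]_a, forall f, mmap iota generic_point f = 0 ->
    mp_at f (exp_graph z) = 0.
Proof.
move=> sec; have [A clA] := locus_closed.
have [z [[_ zP] _]] := sec a locus A clA locus_irreducible locus_rotund locus_free.
by exists z.
Qed.

End GenericPoint.

(** * Laurent terms *)

(* Laurent polynomials in [x_i] and [y_j, y_j^-1], kept as syntax so that the *)
(* number of [y_j] does not appear in types.                                  *)
Inductive lterm (K : Type) (n : nat) :=
| LC of K
| LX of 'I_n
| LY of nat
| LV of nat
| LAdd of lterm K n & lterm K n
| LMul of lterm K n & lterm K n.

Arguments LC {K n}.
Arguments LX {K n}.
Arguments LY {K n}.
Arguments LV {K n}.

Section LTerm.
Variables (K : Type) (n : nat).
Implicit Types (t u : lterm K n) (P Q : pred nat).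

(** The values s of the inverses are a separate argument, because terms are also evaluated in rings
    without an inverse operation, such as [expoly], where exp(-z) serves as the inverse of
    exp(z). *)
Fixpoint leval (S : comNzRingType) (phi : K -> S) (x : 'I_n -> S)
    (y s : nat -> S) t : S :=
  match t with
  | LC c => phi c
  | LX i => x i
  | LY j => y j
  | LV j => s j
  | LAdd t u => leval phi x y s t + leval phi x y s u
  | LMul t u => leval phi x y s t * leval phi x y s u
  end.

Fixpoint lfree P t : bool :=
  match t with
  | LC _ | LX _ => true
  | LY j | LV j => P j
  | LAdd t u | LMul t u => lfree P t && lfree P u
  end.

Fixpoint lsubst (ty ts : nat -> lterm K n) t : lterm K n :=
  match t with
  | LC c => LC c
  | LX i => LX i
  | LY j => ty j
  | LV j => ts j
  | LAdd t u => LAdd (lsubst ty ts t) (lsubst ty ts u)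
  | LMul t u => LMul (lsubst ty ts t) (lsubst ty ts u)
  end.

Lemma leval_subst (S : comNzRingType) (phi : K -> S) x y s ty ts t :
  leval phi x y s (lsubst ty ts t) =
  leval phi x (fun j => leval phi x y s (ty j)) (fun j => leval phi x y s (ts j)) t.
Proof. by elim: t => //= t -> u ->. Qed.

Lemma lfree_subst P Q ty ts t :
  (forall j, P j -> lfree Q (ty j) /\ lfree Q (ts j)) ->
  lfree P t -> lfree Q (lsubst ty ts t).
Proof.
move=> PQ; elim: t => //= [j /PQ[]|j /PQ[]|t IHt u IHu|t IHt u IHu] //;
by case/andP => /IHt -> /IHu.
Qed.

Lemma sub_lfree P Q t : (forall j, P j -> Q j) -> lfree P t -> lfree Q t.
Proof.
move=> PQ; elim: t => //= t IHt u IHu;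
by case/andP => /IHt -> /IHu.
Qed.

Lemma eq_leval_free P (S : comNzRingType) (phi psi : K -> S) x x' y y' s s' t :
    phi =1 psi -> x =1 x' -> (forall j, P j -> y j = y' j /\ s j = s' j) ->
  lfree P t -> leval phi x y s t = leval psi x' y' s' t.
Proof.
move=> ep ex eys; elim: t => //= [j /eys[]|j /eys[]|t IHt u IHu|t IHt u IHu] //;
by case/andP => /IHt -> /IHu ->.
Qed.

Lemma eq_leval (S : comNzRingType) (phi psi : K -> S) x x' y y' s s' t :
    phi =1 psi -> x =1 x' -> y =1 y' -> s =1 s' ->
  leval phi x y s t = leval psi x' y' s' t.
Proof.
move=> ep ex ey es; apply: (@eq_leval_free predT) => //.
by elim: t => //= t -> u ->.
Qed.

Lemma rmorph_leval (S T : comNzRingType) (g : {rmorphism S -> T}) (phi : K -> S)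
    x y s t :
  g (leval phi x y s t) = leval (g \o phi) (g \o x) (g \o y) (g \o s) t.
Proof. by elim: t => //= t IHt u IHu; rewrite ?rmorphD ?rmorphM /= IHt IHu. Qed.

Lemma lfree_bounded t : exists a, lfree (fun j => (j < a)%N) t.
Proof.
elim: t => [c|i|j|j|t [a ta] u [b ub]|t [a ta] u [b ub]]; [by exists 0%N | by exists 0%N
  | by exists j.+1; rewrite /= ltnSn | by exists j.+1; rewrite /= ltnSn | | ];
exists (maxn a b) => /=; apply/andP; split;
by [apply: sub_lfree ta => j ja; rewrite leq_max ja
   |apply: sub_lfree ub => j jb; rewrite leq_max jb orbT].
Qed.

End LTerm.

Lemma leval_sum (K : nzRingType) n (S : comNzRingType) (phi : {rmorphism K -> S})
    (x : 'I_n -> S) y s I (r : seq I) (P : pred I) F :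
  leval phi x y s (\big[@LAdd K n/LC 0]_(i <- r | P i) F i) =
  \sum_(i <- r | P i) leval phi x y s (F i).
Proof. by apply: (big_morph (leval phi x y s)) => //=; rewrite rmorph0. Qed.

Lemma lfree_sum (K : nzRingType) n P I (r : seq I) (Q : pred I) (F : I -> lterm K n) :
  (forall i, Q i -> lfree P (F i)) -> lfree P (\big[@LAdd K n/LC 0]_(i <- r | Q i) F i).
Proof. by move=> PF; elim/big_rec: _ => //= i t /PF -> ->. Qed.

Definition lpow (K : nzRingType) n (t : lterm K n) k := iter k (LMul t) (LC 1).

Lemma leval_pow (K : nzRingType) n (S : comNzRingType) (phi : {rmorphism K -> S})
    (x : 'I_n -> S) y s t k :
  leval phi x y s (lpow t k) = leval phi x y s t ^+ k.
Proof. by elim: k => [|k IHk] /=; rewrite ?rmorph1 // IHk exprS. Qed.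

Lemma lfree_pow (K : nzRingType) n P (t : lterm K n) k :
  lfree P t -> lfree P (lpow t k).
Proof. by move=> Pt; elim: k => //= k ->; rewrite Pt. Qed.

Lemma place_leval (E L : fieldType) (G : E -> L -> Prop) (K : Type) n (phi : K -> E)
    psi (x : 'I_n -> E) x' y y' s s' (P : pred nat) t : is_place G ->
    (forall c, G (phi c) (psi c)) -> (forall i, G (x i) (x' i)) ->
    (forall j, P j -> G (y j) (y' j) /\ G (s j) (s' j)) -> lfree P t ->
  G (leval phi x y s t) (leval psi x' y' s' t).
Proof.
move=> plG Gphi Gx Gys; elim: t => //= [j /Gys[]|j /Gys[]|t IHt u IHu|t IHt u IHu] //;
case/andP => /IHt Gt /IHu Gu; [exact: placeD|exact: placeM].
Qed.

Lemma derivation_leval_eq0 (K E : comNzRingType) (phi : K -> E) D n (x : 'I_n -> E)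
    y s (P : pred nat) (t : lterm K n) : is_derivation phi D ->
    (forall i, D (x i) = 0) -> (forall j, P j -> D (y j) = 0 /\ D (s j) = 0) ->
  lfree P t -> D (leval phi x y s t) = 0.
Proof.
case=> DD DM DC Dx Dys.
elim: t => //= [j /Dys[]|j /Dys[]|t IHt u IHu|t IHt u IHu] //;
case/andP => /IHt Dt /IHu Du; first by rewrite DD Dt Du addr0.
by rewrite DM Dt Du mulr0 mul0r addr0.
Qed.

Definition teval (K : fieldType) n (x : 'I_n -> K) (y : nat -> K) t : K :=
  leval idfun x y (fun j => (y j)^-1) t.

Definition torus_eq0 (K : fieldType) n (t : lterm K n) :=
  forall x (y : nat -> K), (forall j, y j != 0) -> teval x y t = 0.

Definition lvars (S : Type) n a (x : 'I_n -> S) (y : nat -> S) (i : 'I_(n + a)) : S :=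
  match split i with inl i => x i | inr j => y j end.

Lemma lvars_lshift S n a x y i : @lvars S n a x y (lshift a i) = x i.
Proof. by rewrite /lvars (unsplitK (inl i)). Qed.

Lemma lvars_rshift S n a x y j : @lvars S n a x y (rshift n j) = y j.
Proof. by rewrite /lvars (unsplitK (inr j)). Qed.

Section NormalForm.
Variables (K : fieldType) (n a : nat).
Implicit Types (t u : lterm K n).

(** Clearing denominators uniformly over all K-algebras lets polynomial identities be transported
    from one of them to another. *)
Definition normal_form t (e : nat) (q : {mpoly K[n + a]}) :=
  forall (S : comNzRingType) (phi : {rmorphism K -> S}) (x : 'I_n -> S) (y s : nat -> S),
    (forall j, y j * s j = 1) ->
  (\prod_(j < a) y j) ^+ e * leval phi x y s t = mmap phi (lvars x y) q.

Lemma leval_normal_form t : lfree (fun j => (j < a)%N) t ->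
  exists e q, normal_form t e q.
Proof.
pose Y : {mpoly K[n + a]} := \prod_(j < a) 'X_(rshift n j).
have YE (S : comNzRingType) (phi : {rmorphism K -> S}) x (y : nat -> S) :
    mmap phi (lvars x y) Y = \prod_(j < a) y j.
  rewrite rmorph_prod; apply: eq_bigr => j _.
  by rewrite /= mmapX mmap1U lvars_rshift.
elim: t => [c|i|j|j|t IHt u IHu|t IHt u IHu] /=.
- by exists 0%N, c%:MP => S phi x y s _; rewrite expr0 mul1r mmapC.
- exists 0%N, 'X_(lshift a i) => S phi x y s _.
  by rewrite expr0 mul1r mmapX mmap1U lvars_lshift.
- move=> ja; exists 0%N, 'X_(rshift n (Ordinal ja)) => S phi x y s _.
  by rewrite expr0 mul1r mmapX mmap1U lvars_rshift.
- move=> ja; exists 1%N, (\prod_(k < a | k != Ordinal ja) 'X_(rshift n k)).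
  move=> S phi x y s ys; rewrite expr1 (bigD1 (Ordinal ja)) //= mulrAC ys mul1r.
  rewrite rmorph_prod; apply: eq_bigr => k _.
  by rewrite /= mmapX mmap1U lvars_rshift.
- case/andP => /IHt[e [q tq]] /IHu[d [r ur]].
  exists (e + d)%N, (q * Y ^+ d + r * Y ^+ e) => S phi x y s ys.
  rewrite mmapD !rmorphM !rmorphXn /= YE -(tq _ _ _ _ _ ys) -(ur _ _ _ _ _ ys).
  by rewrite exprD; ring.
- case/andP => /IHt[e [q tq]] /IHu[d [r ur]].
  exists (e + d)%N, (q * r) => S phi x y s ys.
  rewrite rmorphM /= -(tq _ _ _ _ _ ys) -(ur _ _ _ _ _ ys).
  by rewrite exprD; ring.
Qed.

Hypothesis char0 : [pchar K] =i pred0.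

(** The product of q with all y-variables vanishes on the whole affine space, hence is the zero
    polynomial. *)
Lemma torus_mpoly_eq0 (q : {mpoly K[n + a]}) :
  (forall x (y : nat -> K), (forall j, y j != 0) -> q.@[lvars x y] = 0) -> q = 0.
Proof.
move=> q0; pose Y : {mpoly K[n + a]} := \prod_(j < a) 'X_(rshift n j).
have Y0 : Y != 0.
  by apply/prodf_neq0 => j _; rewrite -msize_poly_eq0 msizeX.
apply/eqP; suff: q * Y == 0 by rewrite mulf_eq0 (negbTE Y0) orbF.
apply/eqP/(meval_eq0 char0) => v; rewrite mevalM.
have [v0|/forallPn[j /negPn/eqP vj]] := boolP [forall j : 'I_a, v (rshift n j) != 0].
  pose y j := if insub j is Some k then v (rshift n k) else 1.
  have yE (j : 'I_a) : y j = v (rshift n j) by rewrite /y valK.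
  rewrite -[RHS](mul0r Y.@[v]) -[X in _ = X * _](q0 (fun i => v (lshift a i)) y).
    congr (_ * _); apply: meval_eq => i; rewrite /lvars.
    by case: splitP => k ik; rewrite ?yE; congr v; apply: val_inj.
  move=> j; rewrite /y; case: insubP => [k _ _|_]; last exact: oner_neq0.
  exact: (forallP v0).
rewrite [Y.@[v]]rmorph_prod (bigD1 j) //= mevalXU vj.
by rewrite mul0r mulr0.
Qed.

Lemma torus_normal_form_eq0 t e q : normal_form t e q -> torus_eq0 t -> q = 0.
Proof.
move=> tq t0; apply: torus_mpoly_eq0 => x y y0.
by rewrite /meval -(tq K idfun x y (fun j => (y j)^-1)) ?[leval _ _ _ _ _]t0 ?mulr0 //
   => j; rewrite divff.
Qed.

End NormalForm.

Section Transfer.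
Variables (K : fieldType) (n : nat).
Hypothesis char0 : [pchar K] =i pred0.

(** The bridge from identities checked at K-points of the torus to identities in any commutative
    K-algebra, in particular in [expoly]: the numerator in the normal form is the zero
    polynomial. *)
Lemma torus_eq0_leval (t : lterm K n) (S : comNzRingType) (phi : {rmorphism K -> S})
    x y s :
  torus_eq0 t -> (forall j, y j * s j = 1) -> leval phi x y s t = 0.
Proof.
move=> t0 ys; have [a ta] := lfree_bounded t.
have [e [q tq]] := leval_normal_form ta.
have := tq S phi x y s ys; rewrite (torus_normal_form_eq0 char0 tq t0) mmap0.
move/(congr1 (fun v => (\prod_(j < a) s j) ^+ e * v)).
rewrite mulr0 mulrA -exprMn -big_split /= big1 ?expr1n ?mul1r // => j _.
by rewrite mulrC.
Qed.

Lemma torus_eq_leval (t u : lterm K n) (S : comNzRingType)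
    (phi : {rmorphism K -> S}) x y s :
  (forall x (y : nat -> K), (forall j, y j != 0) -> teval x y t = teval x y u) ->
  (forall j, y j * s j = 1) -> leval phi x y s t = leval phi x y s u.
Proof.
move=> tu ys; apply/eqP; rewrite -subr_eq0; apply/eqP.
have := @torus_eq0_leval (LAdd t (LMul (LC (-1)) u)) S phi x y s _ ys.
rewrite /= rmorphN1 mulN1r; apply => x' y' y'0.
by rewrite /teval /= -!/(teval _ _ _) tu // mulN1r subrr.
Qed.

End Transfer.

(** * The generic point of the torus *)

Section Generic.
Variables (K : fieldType) (n a : nat) (F : fieldType).
Variable tf : {rmorphism {mpoly K[n + a]} -> F}.
Hypothesis tf_inj : injective tf.
Hypothesis char0 : [pchar K] =i pred0.

Definition genC (c : K) : F := tf c%:MP.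
Definition genx (i : 'I_n) : F := tf 'X_(lshift a i).
(** The default 1 outside the range keeps every [geny j] invertible. *)
Definition geny (j : nat) : F :=
  if insub j is Some k then tf 'X_(rshift n (k : 'I_a)) else 1.
Definition geneval (t : lterm K n) : F :=
  leval genC genx geny (fun j => (geny j)^-1) t.

HB.instance Definition _ := GRing.RMorphism.copy genC (tf \o @mpolyC _ K).

Lemma genyE (j : 'I_a) : geny j = tf 'X_(rshift n j).
Proof. by rewrite /geny valK. Qed.

Lemma geny_neq0 j : geny j != 0.
Proof.
rewrite /geny; case: insubP => [k _ _|_]; last exact: oner_neq0.
by rewrite -(rmorph0 tf) (inj_eq tf_inj) -msize_poly_eq0 msizeX.
Qed.

Lemma mmap_gen q : mmap genC (lvars genx geny) q = tf q.
Proof.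
elim/mpoly_ring_ind: q => [c|i|p q IHp IHq|p q IHp IHq].
- by rewrite mmapC.
- rewrite mmapX mmap1U /lvars; case: splitP => k ik.
    by congr (tf 'X__); apply: val_inj.
  by rewrite genyE; congr (tf 'X__); apply: val_inj.
- by rewrite mmapD IHp IHq rmorphD.
- by rewrite !rmorphM /= IHp IHq.
Qed.

Lemma geneval_normal_form t e q : normal_form t e q ->
  (\prod_(j < a) geny j) ^+ e * geneval t = tf q.
Proof.
move=> tq; rewrite -mmap_gen -(tq _ genC _ _ (fun j => (geny j)^-1)) // => j.
by rewrite divff ?geny_neq0.
Qed.

(* The local ring of F at the point (x, y) of the torus. *)
Lemma torus_place x y : (forall j, y j != 0) -> exists G : F -> K -> Prop,
  [/\ is_place G, forall c, G (genC c) c, forall i, G (genx i) (x i) &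
      forall j, (j < a)%N -> G (geny j) (y j) /\ G (geny j)^-1 (y j)^-1].
Proof.
move=> y0; pose h : {rmorphism {mpoly K[n + a]} -> K} := meval (lvars x y).
exists (frac_place tf h); split=> [|c|i|j ja].
- exact: frac_placeP.
- by have := frac_place_tf tf h c%:MP; rewrite /h /= mevalC.
- by have := frac_place_tf tf h 'X_(lshift a i); rewrite /h /= mevalXU lvars_lshift.
have -> : j = Ordinal ja by [].
rewrite genyE; split.
  by have := frac_place_tf tf h 'X_(rshift n (Ordinal ja)); rewrite /h /= mevalXU lvars_rshift.
exists 1, 'X_(rshift n (Ordinal ja)).
by rewrite /h /= mevalXU lvars_rshift !rmorph1 !div1r; split=> //; apply: y0.
Qed.

Lemma geneval_torus_eq0 t : lfree (fun j => (j < a)%N) t ->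
  geneval t = 0 -> torus_eq0 t.
Proof.
move=> ta gt0 x y y0; have [G [plG GC Gx Gy]] := torus_place x y0.
by apply: (place0_eq0 plG); rewrite -gt0; apply: (place_leval plG GC Gx Gy).
Qed.

(* Euler's operators act diagonally on Laurent monomials, so that a Laurent   *)
(* polynomial killed by all partial derivatives is constant.                  *)
Lemma geneval_deriv_eq0 t (D : 'I_(n + a) -> F -> F) :
    lfree (fun j => (j < a)%N) t ->
    (forall c, is_derivation genC (D c)) ->
    (forall c q, D c (tf q) = tf q^`M(c)) ->
    (forall c, D c (geneval t) = 0) ->
  exists k, geneval t = genC k.
Proof.
move=> ta derD Dtf Dt0; have [e [q tq]] := leval_normal_form ta.
have gtq := geneval_normal_form tq.
pose ex (i : 'I_(n + a)) : nat := if split i is inl _ then 0%N else e.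
pose me : 'X_{1..n + a} := [multinom ex i | i < n + a].
pose Y : {mpoly K[n + a]} := 'X_[me].
have YE : tf Y = (\prod_(j < a) geny j) ^+ e.
  rewrite /Y mpolyXE_id rmorph_prod big_split_ord /= big1 => [|i _].
    rewrite mul1r -prodrXl; apply: eq_bigr => j _.
    by rewrite rmorphXn mnmE /ex (unsplitK (inr j)) -genyE.
  by rewrite mnmE /ex (unsplitK (inl i)) expr0 rmorph1.
have Y0 : tf Y != 0.
  by rewrite YE expf_neq0 //; apply/prodf_neq0 => j _; apply: geny_neq0.
have dY i : 'X_i * Y^`M(i) = (ex i)%:R * Y.
  rewrite /Y mderivX mnmE -mul_mpolyC mulrCA -mpolyXD mpolyC_nat.
  have [->|ex0] := eqVneq (ex i) 0%N; first by rewrite !mul0r.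
  congr (_ * 'X_[_]); apply/mnmP => j; rewrite mnmDE mnmBE mnm1E.
  by case: eqVneq => [<-|_]; rewrite ?add0n ?subn0 // mnmE addnC subnK // lt0n.
(* As q equals Y times an element killed by all derivations, q is an eigenvector of each Euler
   operator with the same eigenvalue as the monomial Y; so [me] is the only exponent that can occur
   in q. *)
have qE (i : 'I_(n + a)) : 'X_i * q^`M(i) = (ex i)%:R * q.
  apply: tf_inj; rewrite !rmorphM /= -Dtf -gtq -YE.
  case: (derD i) => _ DM _; rewrite DM Dt0 mulr0 addr0 Dtf [LHS]mulrA -[in LHS]rmorphM dY.
  by rewrite rmorphM mulrA.
have qC m : m != me -> q@_m = 0.
  move=> mne; have [i mi] : exists i, m i != me i.
    apply/existsP; apply: contraNT mne; rewrite negb_exists => /forallP mm.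
    by apply/eqP/mnmP => i; have := mm i; rewrite negbK => /eqP.
  have coefl : ('X_i * q^`M(i))@_m = (m i)%:R * q@_m.
    have [mi0|mi1] := eqVneq (m i) 0%N.
      rewrite mi0 mul0r mulrC; apply/memN_msupp_eq0; rewrite (perm_mem (msuppMX _ _)).
      apply/mapP => [[m' _ mE]]; move/eqP: mi0.
      by rewrite mE mnmDE mnm1E eqxx addn_eq0 ?andbF.
    rewrite mulrC -{1}(submK (_ : U_(i) <= m)%MM) ?lep1mP // addmC mcoeffMX mcoeff_mderiv.
    rewrite submK ?lep1mP // mnmBE mnm1E eqxx subn1 prednK ?lt0n //.
    by rewrite mulr_natl.
  have := congr1 (mcoeff m) (qE i); rewrite coefl.
  rewrite -mpolyC_nat mcoeffCM => /eqP.
  rewrite -subr_eq0 -mulrBl mulf_eq0 => /orP[|/eqP //].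
  rewrite subr_eq0 => /eqP eqn; case/eqP: mi; rewrite [RHS]mnmE.
  apply/eqP; wlog: eqn / (ex i <= m i)%N => [W|le].
    case/orP: (leq_total (ex i) (m i)) => le; first exact: W.
    by rewrite eqn_leq le /= -subn_eq0 -(natr_eq0_pchar0 char0) natrB // eqn subrr.
  by rewrite eqn_leq le andbT -subn_eq0 -(natr_eq0_pchar0 char0) natrB // eqn subrr.
have qY : q = (q@_me)%:MP * Y.
  apply/mpolyP => m; rewrite mcoeffCM mcoeffX.
  by case: eqVneq => [->|mm]; rewrite ?mulr1 // mulr0 qC // eq_sym.
exists q@_me; apply: (mulfI Y0).
by rewrite {1}YE gtq {1}qY rmorphM mulrC.
Qed.

End Generic.

(** * Zeros of Laurent terms on exponential points *)

Lemma irreducible_dvdp (F : fieldType) (Q : {poly F}) : (1 < size Q)%N ->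
  exists2 P, irreducible_poly P & P %| Q.
Proof.
elim: {Q}(size Q) {-2}Q (leqnn (size Q)) => [|k IHk] Q szQ Q1.
  by move: Q1; rewrite ltnNge (leq_trans szQ).
have [irrQ|nirrQ] := EM (irreducible_poly Q); first by exists Q.
have [d [d1 dQ ndQ]] : exists d : {poly F}, [/\ size d != 1%N, d %| Q & ~~ (d %= Q)].
  apply: contrapT => h; apply: nirrQ; split=> // d d1 dQ.
  by apply/negPn/negP => ndQ; apply: h; exists d.
have Q0 : Q != 0 by rewrite -size_poly_gt0 ltnW.
have d0 : d != 0 by apply: contraTneq dQ => ->; rewrite dvd0p.
have ltdQ : (size d < size Q)%N.
  rewrite ltn_neqAle dvdp_leq // andbT.
  by apply: contra ndQ; rewrite dvdp_size_eqp.
have [||P irrP Pd] := IHk d.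
- by rewrite -ltnS (leq_trans ltdQ).
- by have := size_poly_gt0 d; rewrite d0; case: (size d) d1 => [|[]].
by exists P => //; apply: dvdp_trans dQ.
Qed.

(** Strip off factors X until the constant term is nonzero. What remains is a constant or has an
    irreducible factor, and such a factor does not vanish at 0, so its roots are admissible values
    of an exponential. *)
Lemma monomial_or_irreducible (F : fieldType) (Q : {poly F}) :
  (exists c k, Q = c *: 'X^k) \/
  exists P, [/\ P \is monic, irreducible_poly P, P %| Q & ~~ root P 0].
Proof.
elim: {Q}(size Q) {-2}Q (leqnn (size Q)) => [|k IHk] Q szQ.
  left; exists 0, 0%N; rewrite scale0r; apply/eqP.
  by rewrite -size_poly_eq0 -leqn0.
have [sz1|sz1] := leqP (size Q) 1.
  by left; exists Q`_0, 0%N; rewrite expr0 alg_polyC; apply: size1_polyC.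
have [/factor_theorem[Q1 QE]|Q0] := boolP (root Q 0).
  have Q10 : Q1 != 0.
    by apply: contraTneq sz1 => Q10; rewrite QE Q10 mul0r size_poly0.
  have szQ1 : (size Q1 <= k)%N.
    by rewrite -ltnS (leq_trans _ szQ) // QE size_Mmonic ?monicXsubC // size_XsubC addn2.
  case: (IHk Q1 szQ1) => [[c [l Q1E]]|[P [monP irrP PQ P0]]].
    by left; exists c, l.+1; rewrite QE Q1E subr0 -scalerAl exprSr.
  by right; exists P; split=> //; rewrite QE dvdp_mulr.
right; have [P [P1 irrP] PQ] := irreducible_dvdp sz1.
have P0 : P != 0 by rewrite -size_poly_gt0 ltnW.
have lc0 : (lead_coef P)^-1 != 0 by rewrite invr_eq0 lead_coef_eq0.
exists ((lead_coef P)^-1 *: P); split.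
- by rewrite monicE lead_coefZ mulVf // lead_coef_eq0.
- split=> [|d d1 dP]; first by rewrite size_scale.
  rewrite (eqp_rtrans (eqp_scale _ lc0)); apply: irrP => //.
  by move: dP; rewrite dvdpZr.
- by rewrite dvdpZl.
- by rewrite rootZ //; apply: contra Q0; apply: root_dvdp.
Qed.

Lemma dvdp_prod_root (F : fieldType) (P : {poly F}) (c : F) (bs : seq F) :
    (1 < size P)%N -> c != 0 -> P %| \prod_(b <- bs) (c *: 'X - b%:P) ->
  exists2 b, b \in bs & root P (b / c).
Proof.
move=> P1 c0 PQ; apply: contrapT => nroot.
have : coprimep P (\prod_(b <- bs) (c *: 'X - b%:P)).
  rewrite big_seq; apply: (big_ind (coprimep P)); first exact: coprimep1.
    by move=> x y; rewrite coprimepMr => -> ->.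
  move=> b bbs; have -> : c *: 'X - b%:P = c *: ('X - (b / c)%:P).
    by rewrite scalerBr -[c *: _%:P]mul_polyC -rmorphM mulrC divfK.
  rewrite coprimepZr // coprimep_XsubC; apply/negP => Pb.
  by apply: nroot; exists b.
rewrite /coprimep => /eqP szg; have := dvdp_leq _ (_ : P %| gcdp P _).
move/(_ (\prod_(b <- bs) (c *: 'X - b%:P))); rewrite szg.
have g0 : gcdp P (\prod_(b <- bs) (c *: 'X - b%:P)) != 0 by rewrite -size_poly_gt0 szg.
by move=> /(_ g0); rewrite dvdp_gcd dvdpp PQ => /(_ isT); rewrite leqNgt P1.
Qed.

Lemma poly_place_mmap (E L : fieldType) (G : E -> L -> Prop) n (R : nzRingType)
    (f : {rmorphism R -> {poly E}}) (g : {rmorphism R -> {poly L}}) h k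
    (p : {mpoly R[n]}) : is_place G ->
    (forall c, poly_place G (f c) (g c)) -> (forall i, poly_place G (h i) (k i)) ->
  poly_place G (mmap f h p) (mmap g k p).
Proof.
move=> plG Gfg Ghk; elim/mpoly_ring_ind: p => [c|i|p q IHp IHq|p q IHp IHq].
- rewrite !mmapC; exact: Gfg.
- rewrite !mmapX !mmap1U; exact: Ghk.
- by rewrite !mmapD; apply: poly_placeD.
- by rewrite !rmorphM /=; apply: poly_placeM.
Qed.

Lemma poly_placeC (E L : fieldType) (G : E -> L -> Prop) x a :
  is_place G -> G x a -> poly_place G x%:P a%:P.
Proof. by move=> plG Gx i; rewrite !coefC; case: (i == 0)%N => //; apply: place0. Qed.

Lemma poly_placeX (E L : fieldType) (G : E -> L -> Prop) :
  is_place G -> poly_place G 'X 'X.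
Proof.
by move=> plG i; rewrite !coefX; case: (i == 1)%N; [apply: place1|apply: place0].
Qed.

(** * The trichotomy for the last variable *)

Section Trichotomy.
Variables (K : eFieldType) (n a : nat) (f : nat -> lterm K n).
Hypothesis closedK : GRing.closed_field_axiom K.
Hypothesis secK : strong_exp_closed K.
Hypothesis le_na : (n <= a)%N.
Hypothesis f_tri : forall j, (j < a)%N -> lfree (fun k => (k < j)%N) (f j).
(** This is what lets a point (z, y) of V determine x, by x_i = z_i / c. *)
Hypothesis f_x : exists2 c : K, c != 0 & forall i : 'I_n,
  forall (S : comNzRingType) (phi : {rmorphism K -> S}) x y s,
  leval phi x y s (f i) = phi c * x i.
Hypothesis f_free : forall (w : nat -> int) (c : K),
    (forall x (y : nat -> K), (forall j, y j != 0) ->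
      \sum_(j < a) (w j)%:~R * teval x y (f j) = c) ->
  forall j, (j < a)%N -> w j = 0.
Variable i0 : 'I_a.
(** The variable y_(i0) occurs in none of the z_j, so replacing it by an algebraic element leaves
    all z_j as they are. *)
Hypothesis f_i0 : forall j, (j < a)%N -> lfree (fun k => (k < i0)%N) (f j).
Variable t : lterm K n.
Hypothesis t_bound : lfree (fun j => (j < a)%N) t.

Let char0 : [pchar K] =i pred0 := pchar0.

Definition exp_solution (x : 'I_n -> K) (z : nat -> K) :=
  forall j, (j < a)%N -> z j = teval x (fun k => eexp (z k)) (f j).

(** Quantifying over all solutions z loses nothing, as x determines z_j for j < a by the triangular
    shape of f. *)
Definition has_exp_zero :=
  exists x, forall z, exp_solution x z -> teval x (fun k => eexp (z k)) t = 0.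

Definition monomial_in_y0 := exists k : int,
  forall x (y : nat -> K), (forall j, y j != 0) ->
    teval x y t = teval x (fun j => if j == i0 :> nat then 1 else y j) t * y i0 ^ k.

Definition vanishes_on_coset := exists (m : nat) (M : nat -> int) (c : K),
  [/\ (0 < m)%N, c != 0 & forall x (y : nat -> K), (forall j, y j != 0) ->
    teval x (fun j => if j == i0 :> nat then c / \prod_(k < a | k != i0) y k ^ M k
                      else y j ^+ m) t = 0].

Section Generic.
Variables (F : fieldType) (tf : {rmorphism {mpoly K[n + a]} -> F}).
Hypothesis tf_inj : injective tf.
Hypothesis fracF : forall x, exists u d, d != 0 /\ x = tf u / tf d.
Variables (e : nat) (q : {mpoly K[n + a]}).
Hypothesis tq : normal_form t e q.

Let char0F : [pchar F] =i pred0.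
Proof. by move=> p; rewrite (fmorph_pchar (genC tf)) char0. Qed.

(** The unknown is a fresh 'X, distinct from the generic element [geny tf i0] of F. The parameter Y
    allows the other variables to be replaced by their m-th powers later. *)
Definition poly_in_y0 (Y : nat -> F) : {poly F} :=
  mmap (polyC \o genC tf) (lvars (fun i => (genx tf i)%:P)
    (fun j => if j == i0 :> nat then 'X else (Y j)%:P)) q.

Lemma horner_poly_in_y0 (E : fieldType) (iota : {rmorphism F -> E}) Y tau
    (y := fun j => if j == i0 :> nat then tau else iota (Y j)) :
    (forall j, y j != 0) ->
  (\prod_(j < a) y j) ^+ e * leval (iota \o genC tf) (iota \o genx tf) y
     (fun j => (y j)^-1) t = (map_poly iota (poly_in_y0 Y)).[tau].
Proof.
move=> y0; rewrite (tq (iota \o genC tf)) => [|j]; last by rewrite divff.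
rewrite -horner_evalE.
rewrite -[RHS]/((horner_eval tau \o map_poly iota) _) rmorph_mmap.
apply: eq_mmap => [c|i] /=; first by rewrite /horner_eval map_polyC hornerC.
rewrite /lvars /horner_eval; case: (split i) => j; first by rewrite map_polyC hornerC.
by rewrite /y; case: ifP => _; rewrite ?map_polyX ?hornerX ?map_polyC ?hornerC.
Qed.

Lemma horner_poly_in_y0_id Y tau
    (y := fun j => if j == i0 :> nat then tau else Y j) :
    (forall j, y j != 0) ->
  (\prod_(j < a) y j) ^+ e * leval (genC tf) (genx tf) y (fun j => (y j)^-1) t =
    (poly_in_y0 Y).[tau].
Proof.
move=> y0; have := @horner_poly_in_y0 F idfun Y tau y0.
by rewrite map_poly_id.
Qed.

Lemma monomial_case c k : poly_in_y0 (geny tf) = c *: 'X^k -> monomial_in_y0.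
Proof.
move=> QE; pose y1 (j : nat) : F := if j == i0 :> nat then 1 else geny tf j.
have y10 j : y1 j != 0 by rewrite /y1; case: ifP; rewrite ?oner_neq0 ?geny_neq0.
have yE : geny tf =1 (fun j => if j == i0 :> nat then geny tf i0 else geny tf j).
  by move=> j; case: eqP => [->|].
have e1 := horner_poly_in_y0_id (tau := geny tf i0) (Y := geny tf).
have e2 := horner_poly_in_y0_id (tau := 1) (Y := geny tf) y10.
move: e1 e2; rewrite QE !hornerZ !hornerXn expr1n mulr1 => e1 e2.
have {}e1 : (\prod_(j < a) geny tf j) ^+ e * geneval tf t = c * geny tf i0 ^+ k.
  rewrite -e1 => [|j]; last by case: ifP; rewrite geny_neq0.
  congr (_ ^+ _ * _); first by apply: eq_bigr => j _; exact: yE.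
  by apply: eq_leval => // j; rewrite -yE.
(* The shift by e undoes the power of y_(i0) in the common denominator of the normal form. The
   identity holds in F and is carried to each point of the torus by its place. *)
exists (k%:Z - e%:Z) => x y y0; rewrite expfzDr // -invr_expz -!exprnP.
have [G [plG GC Gx Gy]] := torus_place tf_inj x y0.
pose t1 := leval (genC tf) (genx tf) y1 (fun j => (y1 j)^-1) t.
have {}e2 : (\prod_(j < a) y1 j) ^+ e * t1 = c := e2.
have y1i0 : y1 i0 = 1 by rewrite /y1 eqxx.
have prodE : \prod_(j < a) geny tf j = geny tf i0 * \prod_(j < a) y1 j.
  rewrite (bigD1 i0) //= [in RHS](bigD1 i0) //= y1i0 mul1r; congr (_ * _).
  by apply: eq_bigr => j ji; rewrite /y1 val_eqE (negbTE ji).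
have P10 : (\prod_(j < a) y1 j) ^+ e != 0.
  by rewrite expf_neq0 //; apply/prodf_neq0.
have te : geneval tf t * geny tf i0 ^+ e = t1 * geny tf i0 ^+ k.
  by apply: (mulfI P10); rewrite [RHS]mulrA e2 -e1 prodE exprMn; ring.
have Gt : G (geneval tf t) (teval x y t) by apply: (place_leval plG GC Gx Gy).
have Gt1 : G t1 (teval x (fun j => if j == i0 :> nat then 1 else y j) t).
  apply: (place_leval plG GC Gx _ t_bound) => j ja; rewrite /y1.
  by case: eqP => [_|_]; [rewrite !invr1; split; apply: (place1 plG) | apply: Gy].
have [Gy0 _] := Gy i0 (ltn_ord i0).
have := place_fun plG (placeM plG Gt (placeX plG e Gy0)).
rewrite te => /(_ _ (placeM plG Gt1 (placeX plG k Gy0))) tyE.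
have ye0 : y i0 ^+ e != 0 by rewrite expf_neq0.
by apply: (mulIf ye0); rewrite tyE -!mulrA mulVf ?mulr1.
Qed.

Section Root.
Variable P : {poly F}.
Hypothesis monP : P \is monic.
Hypothesis irrP : irreducible_poly P.
Hypothesis PQ : P %| poly_in_y0 (geny tf).
Hypothesis P0 : ~~ root P 0.
Variables (E : fieldType) (iota : {rmorphism F -> E}) (rho : E).
Hypothesis Prho : root (map_poly iota P) rho.
Hypothesis genE : forall x, exists r, x = (map_poly iota r).[rho].

Let rho0 : rho != 0.
Proof.
apply: contra P0 => /eqP rho0; move: Prho; rewrite rho0 /root -(rmorph0 iota).
by rewrite horner_map (inj_eq (fmorph_inj iota)).
Qed.

Definition yh (j : nat) : E := if j == i0 :> nat then rho else iota (geny tf j).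

Lemma yh_neq0 j : yh j != 0.
Proof. by rewrite /yh; case: ifP => _; rewrite ?fmorph_eq0 ?geny_neq0. Qed.

(** The relation makes rho a root of N X^m - b, with N a Laurent monomial in the other variables, so
    P divides this polynomial. After y_j -> y_j^m it becomes N^m X^m - b, which splits into factors
    N X - c with c^m = b. So the image of P has a root c / N, and t vanishes there. *)
Lemma coset_case (w : 'I_a -> int) b : (0 < w i0) ->
  \prod_(j < a) yh j ^ w j = iota (genC tf b) -> vanishes_on_coset.
Proof.
move=> w0 wb; pose m := `|w i0|%N; have m0 : (0 < m)%N by rewrite absz_gt0 gt_eqF.
have wm : w i0 = m%:Z by rewrite gtz0_abs.
pose N (Y : nat -> F) := \prod_(j < a | j != i0) Y j ^ w j.
have N0 Y : (forall j, Y j != 0) -> N Y != 0.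
  by move=> Y0; apply/prodf_neq0 => j _; rewrite expfz_neq0.
have PN : P %| N (geny tf) *: 'X^m - (genC tf b)%:P.
  apply: (dvdp_root_ext irrP Prho); rewrite rmorphB /= map_polyZ map_polyXn map_polyC.
  rewrite hornerD hornerN hornerZ hornerXn hornerC /= -wb (bigD1 i0) //= {1}/yh eqxx wm.
  rewrite mulrC rmorph_prod; apply/eqP; rewrite subr_eq0; apply/eqP; congr (_ * _).
  by apply: eq_bigr => j ji; rewrite /yh val_eqE (negbTE ji) fmorphXz.
have b0 : b != 0.
  apply/eqP => b0; have /eqP := wb; rewrite b0 !rmorph0 -[_ == 0]negbK.
  by have -> // : \prod_(j < a) yh j ^ w j != 0; apply/prodf_neq0 => j _;
     rewrite expfz_neq0 ?yh_neq0.
pose Ym j := geny tf j ^+ m.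
have Ym0 j : Ym j != 0 by rewrite expf_neq0 ?geny_neq0.
pose h : {rmorphism {mpoly K[n + a]} -> F} := mmap (genC tf) (lvars (genx tf) Ym).
(* The m-th power map is onto on the K-points of the torus, so the substitution y_j -> y_j^m is
   injective on polynomials and the place G it induces is defined on all of F. *)
have h_inj p : h p = 0 -> p = 0.
  move=> hp; apply: (torus_mpoly_eq0 char0) => x y y0.
  have /choice[r rP] (j : nat) : exists r, r ^+ m = y j by exact: closed_field_rootn.
  have r0 j : r j != 0.
    by apply: contraNneq (y0 j) => rj; rewrite -rP rj expr0n gtn_eqF.
  have [G [plG GC Gx Gy]] := torus_place tf_inj x r0.
  apply: (place0_eq0 plG); rewrite -hp /h /= /meval.
  apply: (@place_mmap F K G plG _ _ (genC tf) idfun) => // i; rewrite /lvars; case: splitP => // j _.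
  by rewrite -rP; apply: placeX => //; case: (Gy j).
pose G := frac_place tf h; have plG : is_place G := frac_placeP tf_inj h.
have Gtot x : exists k, G x k.
  have [u [d [d0 ->]]] := fracF x; exists (h u / h d), u, d; split=> //.
  by apply: contra_neq d0 => /h_inj.
have GC c : G (genC tf c) (genC tf c).
  by have := frac_place_tf tf h c%:MP; rewrite /h /= mmapC.
have Gx i : G (genx tf i) (genx tf i).
  by have := frac_place_tf tf h 'X_(lshift a i); rewrite /h /= mmapX mmap1U lvars_lshift.
have Gy (j : 'I_a) : G (geny tf j) (Ym j).
  have := frac_place_tf tf h 'X_(rshift n j).
  by rewrite /h /= mmapX mmap1U lvars_rshift genyE.
have Gyv (j : 'I_a) : G (geny tf j)^-1 (Ym j)^-1.
  have [k Gk] := Gtot (geny tf j)^-1.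
  by have [_ <-] := placeV plG (geny_neq0 tf_inj j) (Gy j) Gk.
have [P' GP] := poly_place_lift plG (fun i => Gtot P`_i).
have [monP' szP'] := poly_place_monic plG monP GP.
have P'1 : (1 < size P')%N by rewrite szP'; case: irrP.
have GN : G (N (geny tf)) (N (geny tf) ^+ m).
  rewrite -[X in G _ X]prodrXl; apply: (place_prod plG) => j _.
  rewrite [X in G _ X]exprnP exprzAC -exprnP; apply: (place_expz plG).
  - exact: geny_neq0.
  - exact: Gy.
  - exact: Gyv.
have P'N : P' %| N (geny tf) ^+ m *: 'X^m - (genC tf b)%:P.
  apply: (poly_place_dvdp plG monP GP _ PN); apply: (poly_placeB plG).
    rewrite -[_ *: _]mulr1 -[X in poly_place _ _ X]mulr1.
    by apply: (poly_placeZXn plG) => //; rewrite -!polyC1; apply: poly_placeC => //; apply: place1.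
  exact: poly_placeC.
have P'Q : P' %| poly_in_y0 Ym.
  apply: (poly_place_dvdp plG monP GP _ PQ); apply: poly_place_mmap => // [c|i].
    exact: (poly_placeC plG (GC c)).
  rewrite /lvars; case: splitP => j _; first exact: poly_placeC.
  by case: eqP => _; [apply: poly_placeX|apply: poly_placeC].
have [bs bsE] : exists bs : seq K, 'X^m - b%:P = \prod_(c <- bs) ('X - c%:P).
  by apply: closed_field_split => //; apply: monicXnsubC.
have NbE : N (geny tf) ^+ m *: 'X^m - (genC tf b)%:P =
    \prod_(c <- map (genC tf) bs) (N (geny tf) *: 'X - c%:P).
  have := congr1 (fun p => map_poly (genC tf) p \Po (N (geny tf) *: 'X)) bsE.
  rewrite rmorphB /= map_polyXn map_polyC /= comp_polyB comp_polyC comp_Xn_poly.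
  rewrite exprZn => ->; rewrite rmorph_prod big_map.
  rewrite -[LHS]/(comp_poly _ _) rmorph_prod; apply: eq_bigr => c _.
  by rewrite /= map_polyXsubC comp_polyB comp_polyX comp_polyC.
move: P'N; rewrite NbE => /(dvdp_prod_root P'1 (N0 _ (geny_neq0 tf_inj))).
case=> _ /mapP[c cbs ->] P'c.
have c0 : c != 0.
  apply: contraNneq b0 => c0; have : root ('X^m - b%:P) c.
    by rewrite bsE root_prod_XsubC.
  by rewrite c0 /root hornerD hornerN hornerC hornerXn expr0n gtn_eqF // sub0r oppr_eq0.
have /eqP Qc := root_dvdp P'Q P'c.
pose y j := if j == i0 :> nat then genC tf c / N (geny tf) else Ym j.
have yn0 j : y j != 0.
  by rewrite /y; case: ifP => _ //; rewrite mulf_neq0 ?invr_eq0 ?fmorph_eq0 ?N0 //;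
    exact: geny_neq0.
have := horner_poly_in_y0_id (Y := Ym) yn0; rewrite Qc => /eqP.
rewrite mulf_eq0 expf_eq0 prodf_seq_eq0.
have /negbTE -> : ~~ has (fun j : 'I_a => true && (y j == 0)) (index_enum 'I_a).
  by apply/hasPn => j _ /=.
rewrite andbF /= => /eqP ty0.
exists m, (fun j => if insub j is Some k then w k else 0), c; split=> // x v v0.
have [G' [plG' GC' Gx' Gy']] := torus_place tf_inj x v0.
apply: (place0_eq0 plG'); rewrite -ty0.
apply: (place_leval plG' GC' Gx' _ t_bound) => j ja; rewrite /y.
have [Gj Gvj] := Gy' j ja.
case: eqP => _; last first.
  by rewrite /Ym -!exprVn; split; apply: placeX.
rewrite !invf_div; have GN' : G' (N (geny tf))
    (\prod_(k < a | k != i0) v k ^ (if insub (val k) is Some k then w k else 0)).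
  apply: (place_prod plG') => k _; rewrite valK.
  by have [Gk Gvk] := Gy' k (ltn_ord k); apply: place_expz => //; apply: geny_neq0.
have GN'v : G' (N (geny tf))^-1
    (\prod_(k < a | k != i0) v k ^ (if insub (val k) is Some k then w k else 0))^-1.
  rewrite -!prodfV; apply: (place_prod plG') => k _; rewrite valK !invr_expz.
  have [Gk Gvk] := Gy' k (ltn_ord k).
  by apply: (place_expz plG') => //; apply: geny_neq0.
split; apply: (placeM plG') => //; rewrite -fmorphV; exact: GC'.
Qed.

Lemma root_derivations : exists (DF : 'I_(n + a) -> F -> F) (D : 'I_(n + a) -> E -> E),
  [/\ forall c, is_derivation (genC tf) (DF c),
      forall c p, DF c (tf p) = tf p^`M(c),
      forall c, is_derivation (iota \o genC tf) (D c)
    & forall c x, D c (iota x) = iota (DF c x)].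
Proof.
have /choice[D DP] c : exists D : (F -> F) * (E -> E),
    [/\ is_derivation (genC tf) D.1, forall p, D.1 (tf p) = tf p^`M(c),
        is_derivation (iota \o genC tf) D.2 & forall x, D.2 (iota x) = iota (D.1 x)].
  have [D1 derD1 D1E] := frac_derivation tf_inj fracF (mderiv_derivation K c).
  have [D2 derD2 D2E] := derivation_ext irrP Prho genE char0F derD1.
  by exists (D1, D2).
by exists (fun c => (D c).1), (fun c => (D c).2); split=> c; case: (DP c).
Qed.

Lemma mderiv_rshift_X (k : 'I_a) i : ('X_i : {mpoly K[n + a]})^`M(rshift n k) =
  (i == rshift n k)%:R.
Proof.
rewrite mderivX mnm1E; case: eqVneq => [->|_]; last by rewrite scale0r.
rewrite scale1r -mpolyX0; congr 'X_[_]; apply/mnmP => j.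
by rewrite mnmBE subnn mnm0E.
Qed.

(** If w k != 0 with k != i0, the logarithmic derivative of the product along y_k is w k / y_k,
    whereas that of a constant is 0. So a multiplicative relation must involve rho. *)
Lemma yh_log_free (w : 'I_a -> int) b : w i0 = 0 -> (exists j, w j != 0) ->
  \prod_(j < a) yh j ^ w j != iota (genC tf b).
Proof.
move=> wi0 [k wk]; have [DF [D [derDF DFE derD DE]]] := root_derivations.
apply/eqP => wb; have := log_deriv_prod (derD (rshift n k)) (index_enum 'I_a)
  (f := fun j : 'I_a => yh j ^ w j) (fun j => _).
have yw0 (j : 'I_a) : yh j ^ w j != 0 by rewrite expfz_neq0 ?yh_neq0.
move=> /(_ yw0); rewrite wb; have [_ _ ->] := derD (rshift n k); rewrite mul0r.
have char0E : [pchar E] =i pred0 by move=> p; rewrite (fmorph_pchar iota) char0F.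
rewrite (bigD1 k) //= big1 ?addr0 => [|j jk].
  rewrite (log_deriv_expz (derD (rshift n k))) ?yh_neq0 // => /esym/eqP.
  have ki0 : k != i0 by apply: contraNneq wk => ->; rewrite wi0.
  rewrite {1}/yh val_eqE (negbTE ki0) DE genyE DFE mderiv_rshift_X eqxx !rmorph1.
  by rewrite !mulf_eq0 intr_eq0_pchar0 // (negbTE wk) oner_eq0 invr_eq0 (negbTE (yh_neq0 k)).
rewrite (log_deriv_expz (derD (rshift n k))) ?yh_neq0 //.
have [->|ji0] := eqVneq j i0; first by rewrite wi0 mul0r.
rewrite {1}/yh val_eqE (negbTE ji0) DE genyE DFE mderiv_rshift_X.
by rewrite (inj_eq (@rshift_inj _ _)) (negbTE jk) !rmorph0 mul0r mulr0.
Qed.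

(** The derivations along the y_k satisfy the triangularity conditions because z_j only contains
    earlier variables, and the z_j are independent modulo constants by [f_free]. So V has a point on
    the graph of exp, and P(rho) = 0 makes t vanish there. *)
Lemma good_case :
  (forall w b, (exists j, w j != 0) -> \prod_(j < a) yh j ^ w j != iota (genC tf b)) ->
  has_exp_zero.
Proof.
move=> yh_free; have [DF [D [derDF DFE derD DE]]] := root_derivations.
have [c c0 fxE] := f_x.
pose zh (j : 'I_a) := iota (geneval tf (f j)); pose iotaC := iota \o genC tf.
have specE : specializable iotaC.
  apply: (specializable_ext irrP Prho genE closedK monP).
  exact: specializable_fraction.
have D_yh (j k : 'I_a) : j != i0 -> k != i0 -> D (rshift n k) (yh j) = (j == k)%:R.
  move=> ji0 _; rewrite /yh val_eqE (negbTE ji0) DE genyE DFE mderiv_rshift_X.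
  by rewrite (inj_eq (@rshift_inj _ _)) !rmorph_nat.
have D_zh (j k : 'I_a) : (j <= k)%N -> k != i0 -> D (rshift n k) (zh j) = 0.
  move=> jk _; rewrite DE.
  have -> : DF (rshift n k) (geneval tf (f j)) = 0; last by rewrite rmorph0.
  apply: (derivation_leval_eq0 (derDF _) _ _ (f_tri (ltn_ord j))) => [i|l lj].
    by rewrite DFE mderiv_rshift_X eq_lrshift rmorph0.
  have la : (l < a)%N by apply: ltn_trans lj (ltn_ord j).
  have Dl0 : DF (rshift n k) (geny tf l) = 0.
    rewrite -[l]/(val (Ordinal la)) genyE DFE mderiv_rshift_X.
    rewrite (inj_eq (@rshift_inj _ _)) -val_eqE /= ltn_eqF ?rmorph0 //.
    exact: leq_trans lj jk.
  split=> //; have := log_derivV (derDF (rshift n k)) (geny_neq0 tf_inj l).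
  rewrite Dl0 mul0r oppr0 => /eqP; rewrite mulf_eq0 invr_eq0 invr_eq0.
  by rewrite (negbTE (geny_neq0 tf_inj l)) orbF => /eqP.
have zh_free (w : 'I_a -> int) : (exists j, w j != 0) ->
    exists k, \sum_j (w j)%:~R * D k (zh j) != 0.
  move=> [j wj]; apply: contrapT => nz; move/eqP: wj; apply.
  pose u := \big[@LAdd K n/LC 0]_(l < a) LMul (LC (w l)%:~R) (f l).
  have uE (S : comNzRingType) (phi : {rmorphism K -> S}) x y s :
      leval phi x y s u = \sum_(l < a) (w l)%:~R * leval phi x y s (f l).
    by rewrite leval_sum; apply: eq_bigr => l _ /=; rewrite rmorph_int.
  have ua : lfree (fun l => (l < a)%N) u.
    apply: lfree_sum => l _ /=; apply: sub_lfree (f_tri (ltn_ord l)) => k kl.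
    exact: ltn_trans kl (ltn_ord l).
  have [k ku] : exists k, geneval tf u = genC tf k.
    apply: (geneval_deriv_eq0 tf_inj char0 ua derDF DFE) => k.
    apply: (fmorph_inj iota); rewrite rmorph0 /geneval uE (derivation_sum (derDF k)).
    rewrite rmorph_sum; apply/eqP/negPn/negP => nz'; apply: nz; exists k.
    apply: contra nz' => /eqP sum0; rewrite -[X in _ == X]sum0; apply/eqP.
    apply: eq_bigr => l _ /=.
    by rewrite (derivation_intr_mul (derDF k)) DE rmorphM rmorph_int.
  have w0 : forall l, (l < a)%N -> (if insub l is Some l' then w l' else 0) = 0.
    apply: (f_free (c := k)) => x y y0.
    have /(_ x y y0) : torus_eq0 (LAdd u (LC (- k))).
      apply: (geneval_torus_eq0 tf_inj); first by rewrite /= ua.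
      by rewrite /geneval /= -/(geneval tf u) ku rmorphN subrr.
    rewrite /teval /= uE => /eqP; rewrite subr_eq0 => /eqP <-.
    by apply: eq_bigr => l _; rewrite valK.
  by have := w0 j (ltn_ord j); rewrite valK.
have [z zP] := @generic_point_on_exp_graph K E iotaC a (n + a) i0 zh yh D
  (@rshift n a) specE (fun j => yh_neq0 j) derD D_yh D_zh zh_free yh_free secK.
pose x i := c^-1 * z 0 (widen_ord le_na i).
pose zz (j : nat) : K := if insub j is Some k then z 0 k else 0.
have zzE (j : 'I_a) : zz j = z 0 j by rewrite /zz valK.
pose gp := generic_point zh (fun j : 'I_a => yh j).
have gpz j : gp (lshift a j) = zh j by rewrite /gp /generic_point (unsplitK (inl j)).
have gpy j : gp (rshift a j) = yh j by rewrite /gp /generic_point (unsplitK (inr j)).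
(* A Laurent term that agrees with a polynomial g at the generic point agrees with g at the
   exponential point: clear denominators, write x_i as z_i / c, and use that the resulting
   polynomial h vanishes on V. *)
have transfer u g : lfree (fun j => (j < a)%N) u ->
    leval iotaC (iota \o genx tf) yh (fun j => (yh j)^-1) u = mmap iotaC gp g ->
  teval x (fun j => eexp (zz j)) u = mp_at g (exp_graph z).
  move=> ua ug; have [d [p up]] := leval_normal_form ua.
  pose Y : {mpoly K[a + a]} := \prod_(j < a) 'X_(rshift a j).
  pose sub (i : 'I_(n + a)) : {mpoly K[a + a]} := match split i with
    | inl i => c^-1%:MP * 'X_(lshift a (widen_ord le_na i))
    | inr j => 'X_(rshift a j) end.
  pose h := Y ^+ d * g - mmap (@mpolyC _ _) sub p.
  have h0 : mmap iotaC gp h = 0.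
    rewrite rmorphB rmorphM rmorphXn /= -ug [mmap _ _ Y]rmorph_prod.
    have -> : \prod_(j < a) mmap iotaC gp 'X_(rshift a j) = \prod_(j < a) yh j.
      by apply: eq_bigr => j _; rewrite mmapX mmap1U gpy.
    rewrite (up E iotaC _ _ _ (fun j => divff (yh_neq0 j))).
    rewrite [X in _ - X]rmorph_mmap; apply/eqP; rewrite subr_eq0; apply/eqP.
    apply: eq_mmap => [k|i] /=; first by rewrite mmapC.
    rewrite /lvars /sub; case: (split i) => j; last by rewrite mmapX mmap1U gpy.
    rewrite rmorphM /= mmapC mmapX mmap1U gpz /zh /geneval /= -rmorphM fxE.
    by rewrite mulrA -rmorphM mulVf // rmorph1 mul1r.
  have := zP h h0; rewrite /mp_at mevalB mevalM rmorphXn /=.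
  have e0 j : eexp (zz j) * eexp (- zz j) = 1 by rewrite -eexp_morph subrr eexp0.
  have en0 j : eexp (zz j) != 0.
    by apply: contra_eq_neq (e0 j) => ->; rewrite mul0r eq_sym oner_neq0.
  have YE : Y.@[fun i => exp_graph z 0 i] = \prod_(j < a) eexp (zz j).
    rewrite [LHS]rmorph_prod; apply: eq_bigr => j _.
    by rewrite /= mevalXU row_mxEr mxE zzE.
  have pE : (mmap (@mpolyC _ _) sub p).@[fun i => exp_graph z 0 i] =
      p.@[lvars x (fun j => eexp (zz j))].
    rewrite [LHS]rmorph_mmap; apply: eq_mmap => [k|i] /=; first by rewrite mevalC.
    rewrite /lvars /sub; case: (split i) => j; last by rewrite mevalXU row_mxEr mxE zzE.
    by rewrite mevalM mevalC mevalXU row_mxEl.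
  rewrite YE pE /meval -(up K idfun x _ (fun j => (eexp (zz j))^-1)) => [|j]; last first.
    by rewrite divff.
  rewrite -mulrBr => /eqP; rewrite mulf_eq0 expf_eq0.
  have /negbTE -> : \prod_(j < a) eexp (zz j) != 0 by apply/prodf_neq0.
  by rewrite andbF subr_eq0 => /eqP.
exists x => w solw.
have wzz j : (j < a)%N -> w j = zz j.
  elim/ltn_ind: j => j IHj ja; rewrite solw //.
  have -> : teval x (fun k => eexp (w k)) (f j) = teval x (fun k => eexp (zz k)) (f j).
    apply: (eq_leval_free _ _ _ (f_tri ja)) => // k kj.
    by rewrite (IHj k kj) // (ltn_trans kj ja).
  have fja : lfree (fun k => (k < a)%N) (f j).
    by apply: sub_lfree (f_tri ja) => k kj; apply: ltn_trans kj ja.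
  rewrite (transfer _ 'X_(lshift a (Ordinal ja)) fja).
    by rewrite /mp_at mevalXU row_mxEl -zzE.
  (* By [f_i0] only variables before y_(i0) occur, and on these [yh] agrees with the generic
     values. *)
  rewrite mmapX mmap1U gpz /zh rmorph_leval.
  apply: (eq_leval_free _ _ _ (f_i0 ja)) => // k ki0 /=.
  by rewrite /yh ltn_eqF // fmorphV.
have -> : teval x (fun k => eexp (w k)) t = teval x (fun k => eexp (zz k)) t.
  by apply: (eq_leval_free _ _ _ t_bound) => // k ka; rewrite wzz.
rewrite (transfer _ 0 t_bound) ?rmorph0 ?mp_at0 //; first by rewrite /mp_at rmorph0.
have := horner_poly_in_y0 (iota := iota) (Y := geny tf) (tau := rho) yh_neq0.
have -> : (map_poly iota (poly_in_y0 (geny tf))).[rho] = 0.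
  by have := PQ => /dvdpP[r ->]; rewrite rmorphM hornerM (rootP Prho) mulr0.
move/eqP; rewrite mulf_eq0 expf_eq0.
have /negbTE -> : \prod_(j < a) yh j != 0 by apply/prodf_neq0 => j _; apply: yh_neq0.
by rewrite andbF => /eqP.
Qed.

End Root.

End Generic.

Lemma zero_trichotomy : [\/ has_exp_zero, monomial_in_y0 | vanishes_on_coset].
Proof.
have [F [tf [tf_inj fracF]]] := fraction_field {mpoly K[n + a]}.
have [e [q tq]] := leval_normal_form t_bound.
have [[c [k QE]]|[P [monP irrP PQ P0]]] := monomial_or_irreducible (poly_in_y0 tf q (geny tf)).
  by apply: Or32; apply: (monomial_case tf_inj tq QE).
have [E [iota [rho [Prho genE]]]] := simple_extension irrP.
have [[w [b [wn0 wb]]]|nbad] := EM (exists (w : 'I_a -> int) b, (exists j, w j != 0) /\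
    \prod_(j < a) yh tf iota rho j ^ w j = iota (genC tf b)); last first.
  apply: Or31; apply: (good_case tf_inj fracF tq monP irrP PQ P0 Prho genE) => w b wn0.
  by apply/eqP => wb; apply: nbad; exists w, b.
apply: Or33; have coset := coset_case tf_inj fracF tq monP irrP PQ P0 Prho.
have [wi0|wi0|wi0] := ltgtP (w i0) 0; [|exact: coset wb|].
- apply: (coset (fun j => - w j) b^-1); first by rewrite Num.Theory.oppr_gt0.
  rewrite !fmorphV -wb -prodfV; apply: eq_bigr => j _.
  by rewrite invr_expz.
- have := yh_log_free tf_inj fracF irrP P0 Prho genE b wi0 wn0.
  by rewrite wb eqxx.
Qed.

End Trichotomy.

(** * Systems of nested exponentials *)

Section Exponential.
Variable R : eRingType.
Implicit Types x : R.

Lemma eexp_addN x : eexp x * eexp (- x) = 1.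
Proof. by rewrite -eexp_morph subrr eexp0. Qed.

Lemma eexp_natr k x : eexp (k%:R * x) = eexp x ^+ k.
Proof.
elim: k => [|k IHk]; first by rewrite mul0r eexp0.
by rewrite -natr1 mulrDl mul1r eexp_morph IHk exprSr.
Qed.

Lemma eexp_sum I (r : seq I) (P : pred I) (F : I -> R) :
  eexp (\sum_(i <- r | P i) F i) = \prod_(i <- r | P i) eexp (F i).
Proof. by apply: (big_morph _ (@eexp_morph R)); exact: eexp0. Qed.

End Exponential.

Section ExponentialField.
Variable K : eFieldType.
Implicit Types x : K.

Lemma eexp_neq0 x : eexp x != 0.
Proof.
by apply: contra_eq_neq (eexp_addN x) => ->; rewrite mul0r eq_sym oner_neq0.
Qed.

Lemma eexpN x : eexp (- x) = (eexp x)^-1.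
Proof.
by apply: (mulfI (eexp_neq0 x)); rewrite eexp_addN divff // eexp_neq0.
Qed.

Lemma eexp_intr (k : int) x : eexp (k%:~R * x) = eexp x ^ k.
Proof.
case: k => k; first exact: eexp_natr.
by rewrite NegzE rmorphN mulNr eexpN eexp_natr.
Qed.

End ExponentialField.

Definition lzpow (K : nzRingType) n (j : nat) (k : int) : lterm K n :=
  match k with Posz k => lpow (LY j) k | Negz k => lpow (LV j) k.+1 end.

Definition lmono (K : nzRingType) n a (c : K) (w : nat -> int) : lterm K n :=
  LMul (LC c) (\big[@LMul K n/LC 1]_(j < a) lzpow K n j (w j)).

Lemma leval_mono (K : nzRingType) n a c w (S : comNzRingType)
    (phi : {rmorphism K -> S}) (x : 'I_n -> S) y s :
  leval phi x y s (lmono n a c w) =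
  phi c * \prod_(j < a) leval phi x y s (lzpow K n j (w j)).
Proof.
rewrite /=; congr (_ * _).
by apply: (big_morph (leval phi x y s)) => //=; rewrite rmorph1.
Qed.

Lemma lfree_mono (K : nzRingType) n a (c : K) w :
  lfree (fun j => (j < a)%N) (lmono n a c w).
Proof.
rewrite /=; elim/big_rec: _ => //= j t _ ->; rewrite andbT /lzpow.
by case: (w j) => k; apply: lfree_pow => /=.
Qed.

Lemma teval_mono (K : fieldType) n a (c : K) w x y :
  teval x y (lmono n a c w) = c * \prod_(j < a) y j ^ w j.
Proof.
rewrite /teval (leval_mono _ _ _ idfun); congr (_ * _); apply: eq_bigr => j _.
rewrite /lzpow; case: (w j) => k; rewrite (leval_pow idfun) //=.
by rewrite NegzE -exprz_inv.
Qed.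

Section Systems.
Variables (K : eFieldType) (n : nat).
Implicit Types (z : nat -> expoly K n) (f : nat -> lterm K n).

Let char0 : [pchar K] =i pred0 := pchar0.

Definition epval z (t : lterm K n) : expoly K n :=
  leval (@epC K n) (@epX K n) (fun j => eexp (z j)) (fun j => eexp (- z j)) t.

(* The exponentials [y_j = exp z_j], j < a, where [z_j] is a Laurent          *)
(* polynomial in x and the earlier [y_k]; the first n of the [z_j] are        *)
(* multiples of the variables.                                                *)
Record esystem a f z : Prop := {
  sys_le : (n <= a)%N;
  sys_tri : forall j, (j < a)%N -> lfree (fun k => (k < j)%N) (f j);
  sys_pure : forall i : 'I_n, lfree pred0 (f i);
  sys_x : exists2 c : K, c != 0 & forall i : 'I_n,
    forall (S : comNzRingType) (phi : {rmorphism K -> S}) x y s,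
    leval phi x y s (f i) = phi c * x i;
  sys_free : forall (w : nat -> int) (c : K),
    (forall x (y : nat -> K), (forall j, y j != 0) ->
      \sum_(j < a) (w j)%:~R * teval x y (f j) = c) ->
    forall j, (j < a)%N -> w j = 0;
  sys_z : forall j, (j < a)%N -> z j = epval z (f j)
}.

Definition torus_monomial a (t : lterm K n) := exists (c : K) (w : nat -> int),
  c != 0 /\ forall x (y : nat -> K), (forall j, y j != 0) ->
    teval x y t = c * \prod_(j < a) y j ^ w j.

Lemma epval_mono z a c w :
  epval z (lmono n a c w) = epC n c * eexp (\sum_(j < a) (w j)%:~R * z j).
Proof.
rewrite /epval leval_mono eexp_sum; congr (_ * _); apply: eq_bigr => j _.
rewrite /lzpow; case: (w j) => k; rewrite leval_pow /=; first by rewrite -eexp_natr.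
by rewrite -eexp_natr NegzE rmorphN mulrN mulNr.
Qed.

Lemma torus_eq_epval z t u :
  (forall x (y : nat -> K), (forall j, y j != 0) -> teval x y t = teval x y u) ->
  epval z t = epval z u.
Proof. by move/(torus_eq_leval char0); apply => j; apply: eexp_addN. Qed.

Section Evaluation.
Variable x : 'I_n -> K.
Let ev : expoly K n -> K := ep_lift idfun x.

Lemma ep_liftN p : ep_lift idfun x (- p) = - ep_lift idfun x p.
Proof.
apply: (addrI (ep_lift idfun x p)); rewrite subrr -(ep_liftD (phi := idfun)) // subrr.
exact: (@ep_liftC K n K idfun (fun=> erefl) x 0).
Qed.

Lemma ep_lift_epval z t :
  ev (epval z t) = teval x (fun j => eexp (ev (z j))) t.
Proof.
rewrite /epval /teval /ev; elim: t => /= [c|i|j|j|t <- u <-|t <- u <-].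
- exact: (@ep_liftC K n K idfun).
- exact: (@ep_liftX K n K idfun).
- exact: (@ep_liftE K n K idfun).
- by rewrite (@ep_liftE K n K idfun) // ep_liftN eexpN.
- exact: (@ep_liftD K n K idfun).
- exact: (@ep_liftM K n K idfun).
Qed.

Lemma sys_solution a f z : esystem a f z -> exp_solution a f x (fun j => ev (z j)).
Proof. by move=> sys j ja; rewrite {1}(sys_z sys ja) ep_lift_epval. Qed.

End Evaluation.

(* Linear independence of the characters 1, y^w and y^w', tested at the       *)
(* points 1, y and y^2.                                                       *)
Lemma shift_monomial_const a (t : lterm K n) d d' : d != d' ->
    torus_monomial a (LAdd t (LC (- d))) -> torus_monomial a (LAdd t (LC (- d'))) ->
  exists c, forall x (y : nat -> K), (forall j, y j != 0) -> teval x y t = c.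
Proof.
move=> dd' [c [w [c0 tw]]] [c' [w' [c'0 tw']]]; exists (d + c) => x y y0.
have chi (v : nat -> int) : \prod_(j < a) (y j ^+ 2) ^ v j = (\prod_(j < a) y j ^ v j) ^+ 2.
  by rewrite -prodrXl; apply: eq_bigr => j _; rewrite [RHS]exprnP exprzAC.
pose delta := d' - d.
have rel (v : nat -> K) : (forall j, v j != 0) ->
    c * \prod_(j < a) v j ^ w j - c' * \prod_(j < a) v j ^ w' j = delta.
  by move=> v0; rewrite -(tw x) // -(tw' x) // /teval /= /delta; ring.
have := rel (fun=> 1) (fun=> oner_neq0 K).
rewrite !big1 ?mulr1 => [e1|j _|j _]; rewrite ?exp1rz //.
have e2 := rel y y0; have := rel (fun j => y j ^+ 2) (fun j => expf_neq0 2 (y0 j)).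
rewrite !chi; move: e2; set u := \prod_(j < a) y j ^ w j; set v := \prod_(j < a) _.
move=> e2 e3; have d0 : delta != 0 by rewrite subr_eq0 eq_sym.
have : c * delta * (u - 1) ^+ 2 = 0.
  have c'v : c' * v = c * u - delta by rewrite -e2; ring.
  have : c' * (c * u ^+ 2 - c' * v ^+ 2 - delta) = 0 by rewrite e3 subrr mulr0.
  have -> : c' * (c * u ^+ 2 - c' * v ^+ 2 - delta) =
    c' * c * u ^+ 2 - (c' * v) ^+ 2 - c' * delta by ring.
  have -> : c' = c - delta by rewrite -e1; ring.
  rewrite (_ : (c - delta) * v = c' * v); last by rewrite -e1; ring.
  rewrite c'v => h; apply: oppr_inj; rewrite oppr0 -[RHS]h; ring.
move/eqP; rewrite mulf_eq0 expf_eq0 mulf_eq0 (negbTE c0) (negbTE d0) /= subr_eq0.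
move/eqP => u1; have := tw x y y0; rewrite -/u u1 mulr1 /teval /= => <-.
by rewrite addrC subrK.
Qed.

(** Induction on b, the number of y-variables allowed in t, with the system itself fixed; the last
    two cases of the trichotomy lead to terms in the first b variables. *)
Lemma exp_zero (HK : zilber_field K) a f z : esystem a f z ->
  forall b t, (b <= a)%N -> lfree (fun j => (j < b)%N) t -> ~ torus_monomial a t ->
  exists x, teval x (fun j => eexp (ep_lift idfun x (z j))) t = 0.
Proof.
move=> sys; elim=> [|b IHb] t ba tb nmono.
  have teq x y y' : teval x y t = teval x y' t.
    by apply: (eq_leval_free _ _ _ tb).
  apply: contrapT => nz; have t0 x y : teval x y t != 0.
    by apply/eqP => xy; apply: nz; exists x; rewrite -xy; apply: teq.
  have [x1 tx1] : exists x1, teval x1 (fun=> 1) t != teval (fun=> 0) (fun=> 1) t.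
    apply: contrapT => h; apply: nmono.
    exists (teval (fun=> 0) (fun=> 1) t), (fun=> 0); split=> // x y y0.
    rewrite big1 ?mulr1 //.
    rewrite (teq _ y (fun=> 1)); apply/eqP/negPn/negP => tx; apply: h.
    by exists x.
  (* Without y-variables t is a polynomial in x; on the line through 0 and x1 it takes different
     values at 0 and 1, so its restriction R is not constant and has a root. *)
  pose R := leval polyC (fun i => (x1 i)%:P * 'X) (fun=> 1) (fun=> 1) t : {poly K}.
  have RE s : R.[s] = teval (fun i => x1 i * s) (fun=> 1) t.
    rewrite -horner_evalE rmorph_leval; apply: eq_leval => [c|i|j|j] /=;
      rewrite /horner_eval ?hornerC //; last by rewrite invr1.
    by rewrite hornerM hornerC hornerX.
  have [|s] := closed_field_root (zf_alg_closed HK) (p := R).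
    apply/eqP => /eqP/size_poly1P[c _ RC]; case/eqP: tx1.
    have eq_teval x x' : x =1 x' -> teval x (fun=> 1) t = teval x' (fun=> 1) t.
      by move=> xx'; apply: eq_leval.
    rewrite (eq_teval _ (fun i => x1 i * 1)) => [|i]; last by rewrite mulr1.
    rewrite [RHS](eq_teval _ (fun i => x1 i * 0)) => [|i]; last by rewrite mulr0.
    by rewrite -!RE RC !hornerC.
  by rewrite /root RE (negbTE (t0 _ _)).
(* The subsystem keeps all n multiples of the variables and ends at y_b when b >= n. In either case
   its z_j contain only y_k with k < b: the first n contain none, and the others are triangular. *)
pose a' := maxn n b.+1.
have a'a : (a' <= a)%N by rewrite geq_max (sys_le sys) ba.
have na' : (n <= a')%N by rewrite leq_maxl.
have ba' : (b < a')%N by rewrite leq_maxr.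
pose i0 := Ordinal ba'.
have tri' j : (j < a')%N -> lfree (fun k => (k < j)%N) (f j).
  by move=> ja; apply: (sys_tri sys); apply: leq_trans a'a.
have free' (w : nat -> int) (c : K) :
    (forall x (y : nat -> K), (forall j, y j != 0) ->
      \sum_(j < a') (w j)%:~R * teval x y (f j) = c) ->
    forall j, (j < a')%N -> w j = 0.
  move=> wc j ja; pose w' j := if (j < a')%N then w j else 0.
  have -> : w j = w' j by rewrite /w' ja.
  apply: (sys_free sys (c := c)); last exact: leq_trans a'a.
  move=> x y y0; rewrite -(wc x y y0).
  rewrite (big_ord_widen a (fun j => (w j)%:~R * teval x y (f j)) a'a).
  rewrite [RHS]big_mkcond /=; apply: eq_bigr => k _.
  by rewrite /w'; case: ifP => // _; rewrite mul0r.
have fi0 j : (j < a')%N -> lfree (fun k => (k < i0)%N) (f j).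
  move=> ja; have [jn|nj] := ltnP j n.
    by apply: sub_lfree (sys_pure sys (Ordinal jn)).
  apply: sub_lfree (tri' j ja) => k kj; apply: leq_trans kj _.
  by move: ja; rewrite leq_max ltnNge nj.
have tb' : lfree (fun j => (j < a')%N) t.
  by apply: sub_lfree tb => j jb; exact: (leq_trans jb ba').
have sol x : exp_solution a' f x (fun j => ep_lift idfun x (z j)).
  by move=> j ja; apply: (sys_solution x sys); apply: leq_trans a'a.
have [[x xP]|[k tk]|[m [M [c [m0 c0 tM]]]]] := zero_trichotomy (zf_alg_closed HK)
  (zf_strong_exp_closed HK) na' tri' (sys_x sys) free' fi0 tb'.
- by exists x; apply: xP.
- pose t1 := lsubst (fun j => if j == b then LC 1 else LY j)
    (fun j => if j == b then LC 1 else LV j) t.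
  have t1E x y : teval x y t1 = teval x (fun j => if j == i0 :> nat then 1 else y j) t.
    rewrite /teval leval_subst; apply: eq_leval => // j /=; case: eqP => //=.
    by rewrite invr1.
  have [||x tx] := IHb t1 (ltnW ba).
  + apply: lfree_subst tb => j /=; rewrite ltnS leq_eqVlt.
    by case: eqP => //= _ jb; split.
  + case=> c [w [c0 tw]]; apply: nmono.
    exists c, (fun j => w j + (if j == b then k else 0)); split=> // x y y0.
    rewrite tk // -t1E tw // -mulrA; congr (_ * _).
    rewrite (bigD1 (Ordinal ba)) //= [in RHS](bigD1 (Ordinal ba)) //= eqxx.
    rewrite expfzDr // mulrAC; congr (_ * _); apply: eq_bigr => j jb.
    by move: jb; rewrite -val_eqE /= => /negbTE ->; rewrite addr0.
  + exists x; rewrite tk ?mul0r // => [|j]; last exact: eexp_neq0.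
    by rewrite -t1E tx mul0r.
- have mK0 : (m%:R : K) != 0 by rewrite natr_eq0_pchar0 // -lt0n.
  (* The logarithm of the coset equation, divided by m: z_b + sum of (M_k / m) z_k = log c. *)
  pose g := LAdd (f b) (\big[@LAdd K n/LC 0]_(k < a' | k != i0)
    LMul (LC ((M k)%:~R / m%:R)) (f k)).
  have gE x y : teval x y g = teval x y (f b) +
      \sum_(k < a' | k != i0) (M k)%:~R / m%:R * teval x y (f k).
    by rewrite /teval /= (leval_sum idfun).
  have gb : lfree (fun j => (j < b)%N) g.
    rewrite /=; apply/andP; split; first exact: (fi0 b ba').
    by apply: lfree_sum => k _ /=; apply: fi0.
  (* If both d and d + tau failed, g would be constant, and m g would be a relation among the z_j in
     which z_b has the nonzero coefficient m. *)
  have [d cd gd] : exists2 d, eexp d = c & ~ torus_monomial a (LAdd g (LC (- d))).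
    have [d cd] := zf_exp_surj HK c0; have [tau tau0 tauE] := zf_exp_ker HK.
    have [mono1|] := EM (torus_monomial a (LAdd g (LC (- d)))); last by exists d.
    exists (d + tau).
      rewrite eexp_morph cd (_ : eexp tau = 1) ?mulr1 //.
      by apply/tauE; exists 1.
    move=> mono2; have [|h gh] := shift_monomial_const _ mono1 mono2.
      by rewrite -subr_eq0 opprD addNKr oppr_eq0.
    suff : (if b == b then m%:Z else M b) = 0.
      by rewrite eqxx => /eqP; rewrite eqz_nat gtn_eqF.
    apply: (free' (fun j => if j == b then m%:Z else M j) (m%:R * h) _ b ba') => x y y0.
    rewrite -(gh x y y0) gE (bigD1 i0) //= eqxx mulrDr mulr_sumr; congr (_ + _).
    apply: eq_bigr => j ji; have -> : (val j == b) = false.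
      by apply/negbTE; rewrite -[b]/(val i0) val_eqE.
    by rewrite mulrA mulrCA divff // mulr1.
  have [|//|x gx] := IHb (LAdd g (LC (- d))) (ltnW ba).
    by apply/andP; split; first exact: gb.
  exists x; pose w j := ep_lift idfun x (z j).
  have wE : w b + \sum_(k < a' | k != i0) (M k)%:~R / m%:R * w k = d.
    have /eqP : teval x (fun j => eexp (w j)) g - d = 0 by exact: gx.
    rewrite subr_eq0 => /eqP <-; rewrite gE.
    rewrite -(sol x b ba'); congr (_ + _); apply: eq_bigr => k _.
    by rewrite -(sol x k (ltn_ord k)).
  (* Evaluate the coset identity at y_j = exp(z_j / m): the m-th powers are exp(z_j), and the
     equation g = d turns the coset value into exp(z_b). *)
  rewrite -[RHS](tM x (fun j => eexp (w j / m%:R))) => [|j]; last exact: eexp_neq0.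
  apply: (eq_leval_free _ _ _ tb') => // j ja.
  have -> : (if j == i0 :> nat then c / \prod_(k < a' | k != i0) eexp (w k / m%:R) ^ M k
      else eexp (w j / m%:R) ^+ m) = eexp (w j); last by [].
  case: eqP => [->|_]; last by rewrite -eexp_natr mulrC divfK.
  have -> : w i0 = d - \sum_(k < a' | k != i0) (M k)%:~R / m%:R * w k.
    by rewrite -wE addrK.
  rewrite eexp_morph cd eexpN eexp_sum; congr (_ / _).
  by apply: eq_bigr => k _; rewrite -eexp_intr mulrA mulrAC.
Qed.

(** * Representing exponential polynomials by systems *)

Definition represented a z (p : expoly K n) :=
  exists2 t, lfree (fun j => (j < a)%N) t & p = epval z t.

Lemma esystem_append a f z u : esystem a f z -> lfree (fun j => (j < a)%N) u ->
    (forall (w : nat -> int) (d : int) (c : K),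
      (forall x (y : nat -> K), (forall j, y j != 0) ->
        \sum_(j < a) (w j)%:~R * teval x y (f j) + d%:~R * teval x y u = c) ->
      d = 0) ->
  esystem a.+1 (fun j => if j == a then u else f j)
    (fun j => if j == a then epval z u else z j).
Proof.
move=> sys ua u_free; set f' := (fun j => _); set z' := (fun j => _).
have fE j : (j < a)%N -> f' j = f j by move=> ja; rewrite /f' ltn_eqF.
have zE j : (j < a)%N -> z' j = z j by move=> ja; rewrite /z' ltn_eqF.
have epE t : lfree (fun j => (j < a)%N) t -> epval z' t = epval z t.
  by apply: eq_leval_free => // j /zE ->.
have fi (i : 'I_n) : f' i = f i by apply: fE; apply: leq_trans (sys_le sys).
have aE : f' a = u by rewrite /f' eqxx.
split.
- exact: leqW (sys_le sys).
- move=> j; rewrite ltnS leq_eqVlt => /orP[/eqP ->|ja]; first by rewrite aE.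
  by rewrite fE //; apply: (sys_tri sys).
- by move=> i; rewrite fi; apply: (sys_pure sys).
- have [c c0 fxE] := sys_x sys; exists c => // i S phi x y s.
  by rewrite fi fxE.
- move=> w c wc; have wE x (y : nat -> K) : (forall j, y j != 0) ->
      \sum_(j < a) (w j)%:~R * teval x y (f j) + (w a)%:~R * teval x y u = c.
    move=> y0; rewrite -(wc x y y0) big_ord_recr /= aE; congr (_ + _).
    by apply: eq_bigr => j _; rewrite fE.
  have wa := u_free w (w a) c wE.
  move=> j; rewrite ltnS leq_eqVlt => /orP[/eqP -> //|ja].
  apply: (sys_free sys (c := c)) ja => x y y0.
  by rewrite -(wE x y y0) wa mul0r addr0.
- move=> j; rewrite ltnS leq_eqVlt => /orP[/eqP ->|ja].
    by rewrite aE epE // /z' eqxx.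
  rewrite zE // fE // epE; first exact: (sys_z sys).
  by apply: sub_lfree (sys_tri sys ja) => k kj; apply: ltn_trans kj ja.
Qed.

Definition lsubst_pow k : lterm K n -> lterm K n :=
  lsubst (fun j => lpow (LY j) k) (fun j => lpow (LV j) k).

Lemma lfree_subst_pow P k t : lfree P t -> lfree P (lsubst_pow k t).
Proof. by apply: lfree_subst => j Pj; split; apply: lfree_pow. Qed.

Lemma leval_subst_pow (S : comNzRingType) (phi : {rmorphism K -> S}) x y s k t :
  leval phi x y s (lsubst_pow k t) =
  leval phi x (fun j => y j ^+ k) (fun j => s j ^+ k) t.
Proof.
by rewrite leval_subst; apply: eq_leval => // j; rewrite leval_pow.
Qed.

Lemma epval_subst_pow z k t : (0 < k)%N ->
  epval (fun j => epC n k%:R^-1 * z j) (lsubst_pow k t) = epval z t.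
Proof.
move=> k0; rewrite /epval leval_subst_pow; apply: eq_leval => // j.
  rewrite -eexp_natr -(rmorph_nat (@epC K n)) mulrA -rmorphM divff ?rmorph1 ?mul1r //.
  by rewrite natr_eq0_pchar0 // -lt0n.
rewrite -eexp_natr mulrN -(rmorph_nat (@epC K n)) mulrA -rmorphM divff ?rmorph1 ?mul1r //.
by rewrite natr_eq0_pchar0 // -lt0n.
Qed.

(** Passing from y_j to its k-th root exp(z_j / k). Independence is preserved since every point of
    the torus has coordinatewise k-th roots. *)
Lemma esystem_refine (closedK : GRing.closed_field_axiom K) a f z k :
    (0 < k)%N -> esystem a f z ->
  esystem a (fun j => LMul (LC k%:R^-1) (lsubst_pow k (f j)))
    (fun j => epC n k%:R^-1 * z j).
Proof.
move=> k0 sys; have kK0 : (k%:R : K) != 0 by rewrite natr_eq0_pchar0 // -lt0n.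
split.
- exact: sys_le sys.
- by move=> j ja /=; apply/lfree_subst_pow/(sys_tri sys).
- by move=> i /=; apply/lfree_subst_pow/(sys_pure sys).
- have [c c0 fxE] := sys_x sys; exists (k%:R^-1 * c); first by rewrite mulf_neq0 ?invr_eq0.
  by move=> i S phi x y s /=; rewrite leval_subst_pow fxE mulrA -rmorphM.
- move=> w c wc; apply: (sys_free sys (c := k%:R * c)) => x y y0.
  have /choice[r rP] j := closed_field_rootn closedK (y j) k0.
  have r0 j : r j != 0.
    by apply: contraNneq (y0 j) => rj; rewrite -rP rj expr0n gtn_eqF.
  rewrite -(wc x r r0) mulr_sumr; apply: eq_bigr => j _.
  have -> : teval x r (LMul (LC k%:R^-1) (lsubst_pow k (f j))) =
      k%:R^-1 * teval x y (f j).
    rewrite /teval /= (leval_subst_pow idfun); congr (_ * _).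
    by apply: eq_leval => // l; rewrite ?exprVn rP.
  by field.
- move=> j ja; rewrite [in LHS](sys_z sys ja).
  by rewrite -(epval_subst_pow z (f j) k0).
Qed.

(** If p is independent of the z_j modulo K, exp(p) becomes a new variable. Otherwise d p + sum of
    w_j z_j is a constant c with d != 0, and once every z_j is divided by |d| the element exp(p) is
    a Laurent monomial with coefficient exp(c / d). *)
Lemma represented_exp (closedK : GRing.closed_field_axiom K) a f z p :
    esystem a f z -> represented a z p ->
  exists a' f' z', [/\ esystem a' f' z',
    forall q, represented a z q -> represented a' z' q & represented a' z' (eexp p)].
Proof.
move=> sys [u ua ->].
have [u_free|] := EM (forall (w : nat -> int) (d : int) (c : K),
      (forall x (y : nat -> K), (forall j, y j != 0) ->
        \sum_(j < a) (w j)%:~R * teval x y (f j) + d%:~R * teval x y u = c) ->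
      d = 0).
  exists a.+1; do 2 eexists; split; first exact: (esystem_append sys ua u_free).
    move=> _ [t ta ->]; exists t; first by apply: sub_lfree ta => j ja; apply: leqW.
    by apply: (eq_leval_free _ _ _ ta) => // j ja; rewrite ltn_eqF.
  by exists (LY a); rewrite /= ?ltnSn // /epval /= eqxx.
move=> h; have [w [d [c [d0 wdc]]]] : exists (w : nat -> int) (d : int) (c : K), d != 0 /\
    forall x (y : nat -> K), (forall j, y j != 0) ->
      \sum_(j < a) (w j)%:~R * teval x y (f j) + d%:~R * teval x y u = c.
  apply: contrapT => nex; apply: h => w d c wdc; apply/eqP/negPn/negP => d0.
  by apply: nex; exists w, d, c.
pose k := `|d|%N; have k0 : (0 < k)%N by rewrite absz_gt0.
have kK0 : (k%:R : K) != 0 by rewrite natr_eq0_pchar0 // -lt0n.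
exists a, (fun j => LMul (LC k%:R^-1) (lsubst_pow k (f j))), (fun j => epC n k%:R^-1 * z j).
split; first exact: esystem_refine.
  move=> _ [t ta ->]; exists (lsubst_pow k t); first exact: lfree_subst_pow.
  by rewrite epval_subst_pow.
(* The refinement divides by |d|, not by d, hence the sign. *)
pose v j := - (Num.sg d * w j).
exists (lmono n a (eexp (c / d%:~R)) v); first exact: lfree_mono.
rewrite epval_mono epC_exp -eexp_morph; congr eexp.
have dK0 : (d%:~R : K) != 0 by rewrite intr_eq0_pchar0.
have uE : epval z u = epC n (c / d%:~R) +
    \sum_(j < a) epC n (- (w j)%:~R / d%:~R) * z j.
  pose t := LAdd (LC (c / d%:~R)) (\big[@LAdd K n/LC 0]_(j < a)
    LMul (LC (- (w j)%:~R / d%:~R)) (f j)).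
  transitivity (epval z t).
    apply: torus_eq_epval => x y y0; apply: (mulfI dK0).
    rewrite [teval x y t]/teval /= (leval_sum idfun) /=.
    rewrite mulrDr mulr_sumr mulrC [d%:~R * _]mulrC divfK //.
    have := wdc x y y0; move/(canRL (addKr _)); rewrite mulrC => ->.
    rewrite addrC -sumrN; congr (_ + _); apply: eq_bigr => j _.
    by rewrite -/(teval _ _ _); field.
  rewrite /epval /= leval_sum; congr (_ + _); apply: eq_bigr => j _ /=.
  by rewrite [in RHS](sys_z sys (ltn_ord j)).
rewrite uE; congr (_ + _); apply: eq_bigr => j _; rewrite mulrA.
rewrite -(rmorph_int (@epC K n)) -rmorphM; congr (epC n _ * _).
have [dneg|dpos|d0'] := ltgtP d 0; last by rewrite d0' eqxx in d0.
  have -> : (k%:R : K) = - d%:~R by rewrite -rmorphN /= -ltz0_abs.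
  by rewrite /v Num.Theory.ltr0_sg // mulN1r opprK invrN mulrN mulNr.
have -> : (k%:R : K) = d%:~R by rewrite -[in RHS](gtz0_abs dpos).
by rewrite /v Num.Theory.gtr0_sg // mul1r rmorphN.
Qed.


(** Each system must keep representing everything represented before, so that for a sum or product
    both subterms are available in the final system. *)
Lemma represented_all (closedK : GRing.closed_field_axiom K) (T : eterm K n) a f z :
    esystem a f z ->
  exists a' f' z', [/\ esystem a' f' z',
    forall q, represented a z q -> represented a' z' q
    & represented a' z' (\pi_(expoly K n)%qT T)].
Proof.
elim: T a f z => [c|i|T IHT U IHU|T IHT|T IHT U IHU|T IHT] a f z sys.
- by exists a, f, z; split=> //; exists (LC c).
- by exists a, f, z; split=> //; exists (LX i).
- have [a1 [f1 [z1 [sys1 ext1 repT]]]] := IHT _ _ _ sys.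
  have [a2 [f2 [z2 [sys2 ext2 [u ua uE]]]]] := IHU _ _ _ sys1.
  exists a2, f2, z2; split=> // [q /ext1/ext2 //|].
  have [t ta tE] := ext2 _ repT; exists (LAdd t u); first by rewrite /= ta.
  by rewrite -Defs.pi_add tE uE.
- have [a1 [f1 [z1 [sys1 ext1 [t ta tE]]]]] := IHT _ _ _ sys.
  exists a1, f1, z1; split=> //; exists (LMul (LC (-1)) t) => //.
  rewrite -Defs.pi_opp tE /epval /= -[RHS]/(epC n (-1) * epval z1 t) rmorphN rmorph1 mulN1r.
  by [].
- have [a1 [f1 [z1 [sys1 ext1 repT]]]] := IHT _ _ _ sys.
  have [a2 [f2 [z2 [sys2 ext2 [u ua uE]]]]] := IHU _ _ _ sys1.
  exists a2, f2, z2; split=> // [q /ext1/ext2 //|].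
  have [t ta tE] := ext2 _ repT; exists (LMul t u); first by rewrite /= ta.
  by rewrite -Defs.pi_mul tE uE.
- have [a1 [f1 [z1 [sys1 ext1 repT]]]] := IHT _ _ _ sys.
  have [a2 [f2 [z2 [sys2 ext2 repE]]]] := represented_exp closedK sys1 repT.
  exists a2, f2, z2; split=> // [q /ext1/ext2 //|].
  by rewrite -Defs.pi_exp.
Qed.

Lemma esystem_variables : esystem n
  (fun j => if insub j is Some i then LX i else LC 0)
  (fun j => if insub j is Some i then epX K i else 0).
Proof.
split=> // [j jn|i||w c wc j jn|j jn].
- by case: insubP.
- by rewrite valK.
- by exists 1 => [|i S phi x y s]; rewrite ?oner_neq0 // valK rmorph1 mul1r.
- have wE (x : 'I_n -> K) : \sum_(k < n) (w k)%:~R * x k = c.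
    rewrite -(wc x (fun=> 1) (fun=> oner_neq0 _)); apply: eq_bigr => k _.
    by rewrite valK.
  have c0 : c = 0 by rewrite -(wE (fun=> 0)) big1 // => k _; rewrite mulr0.
  have := wE (fun k => (k == Ordinal jn)%:R); rewrite c0 (bigD1 (Ordinal jn)) //=.
  rewrite eqxx mulr1 big1 ?addr0 => [/eqP|k /negbTE ->]; last by rewrite mulr0.
  by rewrite intr_eq0_pchar0 // => /eqP.
- by case: insubP => [i _ _|]; rewrite ?jn.
Qed.

End Systems.

Theorem theorem1 (K : eFieldType) (HK : zilber_field K) (n : nat)
    (p : expoly K n) :
  ~ (exists g : expoly K n, p = eexp g) ->
  exists a : 'rV[K]_n, ep_eval a p = 0%R.
Proof.
move=> nexp.
have [a [f [z [sys _ [t ta tE]]]]] :=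
  represented_all (zf_alg_closed HK) (repr p) (esystem_variables K n).
rewrite reprK in tE.
have [|x tx] := exp_zero HK sys (leqnn a) ta.
  (* A monomial c y^w with c = exp(d) is exp(d + sum of w_j z_j), against the assumption on p. *)
  case=> c [w [c0 tw]]; apply: nexp; have [d dc] := zf_exp_surj HK c0.
  exists (epC n d + \sum_(j < a) (w j)%:~R * z j).
  rewrite eexp_morph -epC_exp dc -epval_mono tE; apply: torus_eq_epval => x y y0.
  by rewrite tw // teval_mono.
exists (\row_i x i); rewrite tE /ep_eval.
have -> : (fun i => (\row_i x i) 0 i) = x by apply: funext => i; rewrite mxE.
by rewrite ep_lift_epval.
Qed.
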